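(* Let $p>1$ be a real number and let $k,n\geq1$ be integers. Then $\mathcal{W}_p(\mathbb{R}^k)$ can be embedded isometrically into $\mathcal{W}_p(\mathbb{H}^n)$ if and only if $k\leq n$; likewise, $\mathcal{W}_p(\mathbb{H}^k)$ can be embedded isometrically into $\mathcal{W}_p(\mathbb{H}^n)$ if and only if $k\leq n$.
   Context: Heisenberg group: for an integer $n\geq 1$, $\mathbb{H}^n=\mathbb{R}^n\times\mathbb{R}^n\times\mathbb{R}$ with the group operation $(x,y,z)\ast(x',y',z')=\big(x+x',\,y+y',\,z+z'+2\sum_{i=1}^n(x'_iy_i-x_iy'_i)\big)$. It is endowed with the left-invariant Heisenberg-Korányi metric $d_H((x,y,z),(x',y',z'))=\|(-x,-y,-z)\ast(x',y',z')\|_H$, where $\|(x,y,z)\|_H=\Big(\big(\sum_{i=1}^n(x_i^2+y_i^2)\big)^2+z^2\Big)^{1/4}$. The space $\mathbb{R}^k$ carries the Euclidean distance. Wasserstein space: for a complete separable metric space $(X,\varrho)$ and $p\geq1$, $\mathcal{W}_p(X)$ is the set of Borel probability measures $\mu$ on $X$ with $\int_X\varrho^p(x,\hat x)\,\mathrm{d}\mu(x)<\infty$ for some (hence all) $\hat x\in X$, endowed with the distance $d_{\mathcal{W}_p}(\mu,\nu)=\Big(\inf_{\Pi\in C(\mu,\nu)}\iint_{X\times X}\varrho^p(x,y)\,\mathrm{d}\Pi(x,y)\Big)^{1/p}$, where $C(\mu,\nu)$ is the set of couplings, i.e. Borel probability measures on $X\times X$ with marginals $\mu$ and $\nu$. A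 map $f:(Y,d_Y)\to(Z,d_Z)$ between metric spaces is an isometric embedding if $d_Z(f(y),f(y'))=d_Y(y,y')$ for all $y,y'\in Y$ (no surjectivity required). *)

(* Defs.v *)
From HB Require Import structures.
From mathcomp Require Import all_boot all_order all_algebra.
From mathcomp Require Import all_classical all_reals all_analysis.
From mathcomp Require Import ring lra.

Set Implicit Arguments.
Unset Strict Implicit.
Unset Printing Implicit Defensive.

Import Order.TTheory GRing.Theory Num.Theory.

Local Open Scope classical_set_scope.
Local Open Scope ring_scope.

(* The library's [g_sigma_algebraType] needs a pointed carrier. *)
#[short(type="pmetricType")]
HB.structure Definition PointedMetric (K : numDomainType) :=
  {M of Metric K M & Pointed M}.

Section dot_product.
Context {R : realType}.

Definition dotv n (u v : 'rV[R]_n) : R := \sum_(i < n) u 0 i * v 0 i.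

Lemma dotvC n (u v : 'rV[R]_n) : dotv u v = dotv v u.
Proof. by apply: eq_bigr => i _; rewrite mulrC. Qed.

Lemma dotvDl n (u v w : 'rV[R]_n) : dotv (u + v) w = dotv u w + dotv v w.
Proof. by rewrite -big_split; apply: eq_bigr => i _; rewrite mxE mulrDl. Qed.

Lemma dotvZl n a (u v : 'rV[R]_n) : dotv (a *: u) v = a * dotv u v.
Proof. by rewrite mulr_sumr; apply: eq_bigr => i _; rewrite mxE mulrA. Qed.

Lemma dotvDr n (u v w : 'rV[R]_n) : dotv w (u + v) = dotv w u + dotv w v.
Proof. by rewrite dotvC dotvDl !(dotvC w). Qed.

Lemma dotvZr n a (u v : 'rV[R]_n) : dotv u (a *: v) = a * dotv u v.
Proof. by rewrite dotvC dotvZl dotvC. Qed.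

Lemma dotvNl n (u v : 'rV[R]_n) : dotv (- u) v = - dotv u v.
Proof. by rewrite -scaleN1r dotvZl mulN1r. Qed.

Lemma dotvNr n (u v : 'rV[R]_n) : dotv u (- v) = - dotv u v.
Proof. by rewrite dotvC dotvNl dotvC. Qed.

Lemma dotvv_ge0 n (u : 'rV[R]_n) : 0 <= dotv u u.
Proof. by apply: sumr_ge0 => i _; rewrite -expr2 sqr_ge0. Qed.

Lemma dotvv_eq0 n (u : 'rV[R]_n) : dotv u u = 0 -> u = 0.
Proof.
move=> /eqP; rewrite psumr_eq0; last by move=> i _; rewrite -expr2 sqr_ge0.
move=> /allP u0; apply/rowP => i; rewrite mxE.
by have := u0 i (mem_index_enum i); rewrite /= mulf_eq0 orbb => /eqP.
Qed.

Lemma dotv0l n (u : 'rV[R]_n) : dotv 0 u = 0.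
Proof. by rewrite -(scale0r u) dotvZl mul0r. Qed.

Lemma dotv0r n (u : 'rV[R]_n) : dotv u 0 = 0.
Proof. by rewrite dotvC dotv0l. Qed.

(* Cauchy-Schwarz for the Hermitian product of x + iy and x' + iy' in C^n. *)
Lemma hermitian_CS n (x y x' y' : 'rV[R]_n) :
  (dotv x x' + dotv y y') ^+ 2 + (dotv x' y - dotv x y') ^+ 2 <=
  (dotv x x + dotv y y) * (dotv x' x' + dotv y' y').
Proof.
set D := dotv x x' + dotv y y'; set w := dotv x' y - dotv x y'.
set A := dotv x x + dotv y y; set B := dotv x' x' + dotv y' y'.
have B0 : 0 <= B by rewrite addr_ge0 ?dotvv_ge0.
have [B_eq0|Bn0] := eqVneq B 0.
  have /andP[/eqP x'0 /eqP y'0] : (dotv x' x' == 0) && (dotv y' y' == 0).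
    by rewrite -paddr_eq0 ?dotvv_ge0// -/B B_eq0.
  rewrite /D /w (dotvv_eq0 x'0) (dotvv_eq0 y'0) B_eq0.
  by rewrite !dotv0r ?dotv0l subrr addr0 expr0n/= addr0 mulr0.
have Bgt0 : 0 < B by rewrite lt_neqAle eq_sym Bn0.
have : 0 <= dotv (B *: x - (D *: x' - w *: y')) (B *: x - (D *: x' - w *: y'))
          + dotv (B *: y - (D *: y' + w *: x')) (B *: y - (D *: y' + w *: x')).
  by rewrite addr_ge0 ?dotvv_ge0.
rewrite !(dotvDl, dotvDr, dotvNl, dotvNr, dotvZl, dotvZr).
rewrite (dotvC x' x) (dotvC y' x) (dotvC y' y) (dotvC y x') (dotvC y' x').
set E := (X in 0 <= X).
have -> : E = B * (A * B - (D ^+ 2 + w ^+ 2)).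
  by rewrite /E /A /B /D /w; ring.
by rewrite pmulr_rge0// subr_ge0.
Qed.

End dot_product.

Section euclidean_space.
Context (R : realType) (k : nat).

(* An alias of 'rV[R]_k, whose library topology comes from the sup norm. *)
Definition euclidean := 'rV[R]_k.

Definition euclidean_norm (x : 'rV[R]_k) : R :=
  Num.sqrt (\sum_(i < k) x 0 i ^+ 2).

Definition euclidean_dist (x y : euclidean) : R := euclidean_norm (x - y).

Lemma euclidean_normE (x : 'rV[R]_k) : euclidean_norm x = Num.sqrt (dotv x x).
Proof. by congr Num.sqrt; apply: eq_bigr => i _; rewrite expr2. Qed.

Lemma euclidean_normD (x y : 'rV[R]_k) :
  euclidean_norm (x + y) <= euclidean_norm x + euclidean_norm y.
Proof.
rewrite !euclidean_normE.
set a := Num.sqrt (dotv x x); set b := Num.sqrt (dotv y y).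
have a0 : 0 <= a by exact: sqrtr_ge0.
have b0 : 0 <= b by exact: sqrtr_ge0.
rewrite -(@ler_pXn2r _ 2%N) ?nnegrE ?sqrtr_ge0 ?addr_ge0//.
have aE : a ^+ 2 = dotv x x by rewrite sqr_sqrtr// dotvv_ge0.
have bE : b ^+ 2 = dotv y y by rewrite sqr_sqrtr// dotvv_ge0.
rewrite sqr_sqrtr ?dotvv_ge0// dotvDl !dotvDr -aE -bE (dotvC y x).
suff : dotv x y <= a * b by nra.
have := hermitian_CS x 0 y 0.
rewrite !dotv0r !(addr0, subr0) expr0n/= addr0 -aE -bE -exprMn.
have ab0 : 0 <= a * b by rewrite mulr_ge0.
by move=> h; nra.
Qed.

Lemma euclidean_normN (x : 'rV[R]_k) : euclidean_norm (- x) = euclidean_norm x.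
Proof. by rewrite !euclidean_normE dotvNl dotvNr opprK. Qed.

Lemma euclidean_norm0_eq0 (x : 'rV[R]_k) : euclidean_norm x = 0 -> x = 0.
Proof.
rewrite euclidean_normE => /eqP; rewrite sqrtr_eq0 => x0.
by apply: dotvv_eq0; apply/eqP; rewrite eq_le x0 dotvv_ge0.
Qed.

Let distxx (x : euclidean) : euclidean_dist x x = 0.
Proof. by rewrite /euclidean_dist subrr euclidean_normE dotv0l sqrtr0. Qed.

Let dist_eq0 (x y : euclidean) : euclidean_dist x y = 0 -> x = y.
Proof. by move/euclidean_norm0_eq0/eqP; rewrite subr_eq0 => /eqP. Qed.

Let distC (x y : euclidean) : euclidean_dist x y = euclidean_dist y x.
Proof. by rewrite /euclidean_dist -opprB euclidean_normN. Qed.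

Let dist_triangle (y x z : euclidean) :
  euclidean_dist x z <= euclidean_dist x y + euclidean_dist y z.
Proof.
rewrite /euclidean_dist (_ : x - z = (x - y) + (y - z)) ?euclidean_normD//.
by rewrite addrA subrK.
Qed.

HB.instance Definition _ := Choice.copy euclidean 'rV[R]_k.
HB.instance Definition _ := isPointed.Build euclidean (0 : 'rV[R]_k).
HB.instance Definition _ :=
  isMetric.Build R euclidean distxx dist_eq0 distC dist_triangle.

End euclidean_space.

Section heisenberg_group.
Context (R : realType) (n : nat).

Definition heisenberg := ('rV[R]_n * 'rV[R]_n * R)%type.

Definition heis_mul (g h : heisenberg) : heisenberg :=
  let: (x, y, z) := g in
  let: (x', y', z') := h in
  (x + x', y + y',
   z + z' + 2 * \sum_(i < n) (x' 0 i * y 0 i - x 0 i * y' 0 i)).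

Definition heis_inv (g : heisenberg) : heisenberg :=
  let: (x, y, z) := g in (- x, - y, - z).

Definition heis_norm (g : heisenberg) : R :=
  let: (x, y, z) := g in
  ((\sum_(i < n) (x 0 i ^+ 2 + y 0 i ^+ 2)) ^+ 2 + z ^+ 2) `^ 4^-1.

Definition heis_dist (g h : heisenberg) : R := heis_norm (heis_mul (heis_inv g) h).

Let symplecticE (x y x' y' : 'rV[R]_n) :
  \sum_(i < n) (x' 0 i * y 0 i - x 0 i * y' 0 i) = dotv x' y - dotv x y'.
Proof. by rewrite sumrB. Qed.

Let heis_normE x y z :
  heis_norm (x, y, z) = ((dotv x x + dotv y y) ^+ 2 + z ^+ 2) `^ 4^-1.
Proof. by rewrite /heis_norm -big_split. Qed.

Let heis_norm_ge0 g : 0 <= heis_norm g.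
Proof. by case: g => [[x y] z]; exact: powR_ge0. Qed.

Let heis_norm4 x y z :
  heis_norm (x, y, z) ^+ 4 = (dotv x x + dotv y y) ^+ 2 + z ^+ 2.
Proof.
by rewrite heis_normE -powR_mulrn ?powR_ge0// -powRrM mulVf ?pnatr_eq0//
  powRr1// addr_ge0 ?sqr_ge0.
Qed.

Let heis_norm_mul g h : heis_norm (heis_mul g h) <= heis_norm g + heis_norm h.
Proof.
case: g h => [[x y] z] [[x' y'] z'].
set N := heis_norm (x, y, z); set N' := heis_norm (x', y', z').
have N0 : 0 <= N by exact: heis_norm_ge0.
have N'0 : 0 <= N' by exact: heis_norm_ge0.
rewrite -(@ler_pXn2r _ 4%N) ?nnegrE ?heis_norm_ge0 ?addr_ge0//.
rewrite /heis_mul heis_norm4 symplecticE.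
rewrite !(dotvDl, dotvDr) (dotvC x' x) (dotvC y' y).
have := hermitian_CS x y x' y'.
have := heis_norm4 x y z; have := heis_norm4 x' y' z'.
rewrite -/N -/N'.
set A := dotv x x + dotv y y; set B := dotv x' x' + dotv y' y'.
set D := dotv x x' + dotv y y'; set w := dotv x' y - dotv x y'.
have -> : dotv x x + dotv x x' + (dotv x x' + dotv x' x') +
    (dotv y y + dotv y y' + (dotv y y' + dotv y' y')) = A + B + 2 * D.
  by rewrite /A /B /D; ring.
have A0 : 0 <= A by rewrite addr_ge0 ?dotvv_ge0.
have B0 : 0 <= B by rewrite addr_ge0 ?dotvv_ge0.
move: A B D w A0 B0 => A B D w A0 B0 EN' EN Dw.
(* Minkowski in the plane: (A, z), (B, z') and 2(D, w) have lengths N^2, N'^2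
   and at most 2NN'. *)
have CS (a b c d p q : R) : 0 <= p -> 0 <= q ->
    a ^+ 2 + b ^+ 2 <= p ^+ 2 -> c ^+ 2 + d ^+ 2 <= q ^+ 2 ->
    a * c + b * d <= p * q.
  move=> p0 q0 hp hq.
  apply: (le_trans (ler_norm _)).
  rewrite -(@ler_pXn2r _ 2%N) ?nnegrE ?mulr_ge0// real_normK ?num_real//.
  rewrite exprMn; apply: (@le_trans _ _ ((a ^+ 2 + b ^+ 2) * (c ^+ 2 + d ^+ 2))).
    rewrite -subr_ge0; apply: (@le_trans _ _ ((a * d - b * c) ^+ 2)).
      exact: sqr_ge0.
    by rewrite le_eqVlt; apply/orP; left; apply/eqP; ring.
  by apply: ler_pM => //; rewrite addr_ge0 ?sqr_ge0.
have lAN : A <= N ^+ 2.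
  rewrite -(@ler_pXn2r _ 2%N) ?nnegrE ?sqr_ge0// -exprM EN.
  by rewrite lerDl sqr_ge0.
have lBN : B <= N' ^+ 2.
  rewrite -(@ler_pXn2r _ 2%N) ?nnegrE ?sqr_ge0// -exprM EN'.
  by rewrite lerDl sqr_ge0.
have hA : A ^+ 2 + z ^+ 2 <= (N ^+ 2) ^+ 2 by rewrite -exprM EN.
have hB : B ^+ 2 + z' ^+ 2 <= (N' ^+ 2) ^+ 2 by rewrite -exprM EN'.
have hD : D ^+ 2 + w ^+ 2 <= (N * N') ^+ 2.
  by apply: (le_trans Dw); rewrite exprMn ler_pM.
have h1 := CS _ _ _ _ _ _ (sqr_ge0 N) (sqr_ge0 N') hA hB.
have h2 := CS _ _ _ _ _ _ (sqr_ge0 N) (mulr_ge0 N0 N'0) hA hD.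
have h3 := CS _ _ _ _ _ _ (sqr_ge0 N') (mulr_ge0 N0 N'0) hB hD.
have -> : (A + B + 2 * D) ^+ 2 + (z + z' + 2 * w) ^+ 2 =
  (A ^+ 2 + z ^+ 2) + (B ^+ 2 + z' ^+ 2) + 4 * (D ^+ 2 + w ^+ 2)
  + 2 * (A * B + z * z') + 4 * (A * D + z * w) + 4 * (B * D + z' * w).
  by ring.
have -> : (N + N') ^+ 4 =
  (N ^+ 2) ^+ 2 + (N' ^+ 2) ^+ 2 + 4 * (N * N') ^+ 2
  + 2 * (N ^+ 2 * N' ^+ 2) + 4 * (N ^+ 2 * (N * N')) + 4 * (N' ^+ 2 * (N * N')).
  by ring.
by lra.
Qed.

Let distxx (g : heisenberg) : heis_dist g g = 0.
Proof.
case: g => [[x y] z]; rewrite /heis_dist /heis_mul /heis_inv heis_normE.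
rewrite symplecticE !addNr dotv0l addr0 dotvNl dotvNr (dotvC x) opprK addNr.
by rewrite mulr0 !addr0 expr0n/= addr0 powR0// invr_eq0 pnatr_eq0.
Qed.

Let dist_eq0 (g h : heisenberg) : heis_dist g h = 0 -> g = h.
Proof.
case: g h => [[x y] z] [[x' y'] z'].
rewrite /heis_dist /heis_mul /heis_inv symplecticE.
move=> /(congr1 (fun t => t ^+ 4)); rewrite heis_norm4 expr0n/= => /eqP.
rewrite paddr_eq0 ?sqr_ge0// !expf_eq0/=.
rewrite paddr_eq0 ?dotvv_ge0// => /andP[/andP[/eqP/dotvv_eq0 + /eqP/dotvv_eq0]].
move=> /eqP; rewrite addrC subr_eq0 => /eqP ->.
move=> /eqP; rewrite addrC subr_eq0 => /eqP ->.
rewrite dotvNr dotvNl opprK (dotvC x) addNr mulr0 addr0.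
by rewrite addrC subr_eq0 => /eqP ->.
Qed.

Let distC (g h : heisenberg) : heis_dist g h = heis_dist h g.
Proof.
case: g h => [[x y] z] [[x' y'] z'].
rewrite /heis_dist /heis_mul /heis_inv !heis_normE !symplecticE.
by congr (_ `^ _); rewrite !(dotvDl, dotvDr, dotvNl, dotvNr);
  rewrite (dotvC x' x) (dotvC y' y) (dotvC x' y) (dotvC x y'); ring.
Qed.

Let dist_triangle (k g h : heisenberg) :
  heis_dist g h <= heis_dist g k + heis_dist k h.
Proof.
rewrite /heis_dist.
have -> : heis_mul (heis_inv g) h =
    heis_mul (heis_mul (heis_inv g) k) (heis_mul (heis_inv k) h).
  case: g h k => [[x y] z] [[x' y'] z'] [[a b] c].
  rewrite /heis_mul /heis_inv !symplecticE.
  rewrite !(addrA _ (- _)) !addrK; congr (_, _, _).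
  rewrite !(dotvDl, dotvDr, dotvNl, dotvNr).
  by rewrite (dotvC a y) (dotvC a b) (dotvC a y') (dotvC x' b); ring.
exact: heis_norm_mul.
Qed.

HB.instance Definition _ :=
  Choice.copy heisenberg ('rV[R]_n * 'rV[R]_n * R)%type.
HB.instance Definition _ := isPointed.Build heisenberg (0, 0, 0).
HB.instance Definition _ :=
  isMetric.Build R heisenberg distxx dist_eq0 distC dist_triangle.

End heisenberg_group.

(* Joins the library's product topology and product base point. *)
HB.instance Definition _ (S T : ptopologicalType) := Pointed.on (S * T)%type.

Definition borel (T : ptopologicalType) := g_sigma_algebraType (@open T).

Section wasserstein_space.
Context {R : realType}.
Local Open Scope ereal_scope.

Definition coupling (X : pmetricType R) (mu nu : probability (borel X) R)
    (Pi : probability (borel (X * X)%type) R) : Prop :=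
  forall A : set (borel X), measurable A ->
    Pi (fst @^-1` A) = mu A /\ Pi (snd @^-1` A) = nu A.

Definition finite_moment (X : pmetricType R) (p : R)
    (mu : probability (borel X) R) : Prop :=
  exists x0 : X, \int[mu]_x ((mdist x x0 `^ p)%R)%:E < +oo.

Definition wasserstein (p : R) (X : pmetricType R) :=
  {mu : probability (borel X) R | finite_moment p mu}.

Definition wasserstein_dist (p : R) (X : pmetricType R)
    (mu nu : wasserstein p X) : \bar R :=
  (ereal_inf [set \int[Pi]_z ((mdist z.1 z.2 `^ p)%R)%:E
             | Pi in coupling (sval mu) (sval nu)]) `^ p^-1.

(* [wasserstein_dist] is \bar R-valued but finite on [wasserstein p X], so
   this is equality of real distances. *)
Definition isometric_embedding (p : R) (X Y : pmetricType R)
    (f : wasserstein p X -> wasserstein p Y) : Prop :=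
  forall mu nu, wasserstein_dist (f mu) (f nu) = wasserstein_dist mu nu.

Definition embeds_isometrically (p : R) (X Y : pmetricType R) : Prop :=
  exists f : wasserstein p X -> wasserstein p Y, isometric_embedding f.

End wasserstein_space.

(* Main.v *)
From HB Require Import structures.
Require Import Defs.
From mathcomp Require Import all_boot all_order all_algebra.
From mathcomp Require Import all_classical all_reals all_analysis.
From mathcomp Require Import measurable_realfun ring lra.

Set Implicit Arguments.
Unset Strict Implicit.
Unset Printing Implicit Defensive.

Import Order.TTheory GRing.Theory Num.Theory.
Import numFieldNormedType.Exports.

Local Open Scope classical_set_scope.
Local Open Scope ring_scope.

(** Existence.  A map iota : X -> Y preserving distances induces, by
push-forward, a map W_p(X) -> W_p(Y).  It preserves the Wasserstein distances
as soon as iota has a continuous left inverse r: a coupling of two measures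
carried by iota(X) is carried by iota(X) x iota(X), where r preserves
distances, so pulling it back along r does not change its cost
([embeds_of_retract]).  Padding coordinates with zeros embeds H^k into H^n for
k <= n, and x |-> (x, 0, 0) embeds R^k into H^k.

Obstruction.  Composing with the embedding of W_p(R^k) into W_p(H^k), only an
isometric embedding f of W_p(R^k) into W_p(H^n) has to be considered, and f
matters only on the Dirac masses at +t e_i and -t e_i, for large t.  Let N be
the distance to the origin of H^n.  Up to a bounded error, f(delta_(t e_i)) and
f(delta_(-t e_i)) are at distance t from the Dirac mass at the origin, and they
are at distance 2 t from each other.  Hence every coupling of them, in
particular their product, nearly attains equality on average in
   d(u, v)^p <= (N u + N v)^p <= 2^(p-1) ((N u)^p + (N v)^p).
Since p > 1, near-equality forces N u and N v to be close to each other and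
d(u, v) to be close to their sum ([near_equality]), and then
[heis_dist_parallelogram] forces u to be close to v^-1.  As u and v are
independent, f(delta_(t e_i)) concentrates at a single point up to an error
o(t) ([concentration], [axis_concentration]); using the product coupling avoids
the theory of optimal couplings altogether.

Rescaling these 2k points by 1/t and passing to the limit along an ultrafilter
produces points h_i^+ and h_i^- of H^n with N <= 1, with h_i^+ and h_i^- at
distance at least 2, and with all other distances at most sqrt 2.  Then h_i^-
is the inverse of h_i^+ and both are horizontal of norm 1 ([antipodal]), and
the h_i^+ are orthonormal for the Hermitian product of C^n
([orthogonal_of_dist]), so there are at most n of them ([orthonormal_le]). *)

(** * Push-forwards, Borel maps and continuity of the distance *)

Section push.
Context d d' (S : measurableType d) (T : measurableType d') (R : realType).
Variables (f : S -> T) (mf : measurable_fun setT f) (P : probability S R).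
Local Open Scope ereal_scope.

(** [distribution] for a map whose measurability is a separate proof. *)
Definition push : probability T R :=
  let F : {mfun S >-> T} := HB.pack f (isMeasurableFun.Build _ _ _ _ _ mf) in
  distribution P F.

Lemma integral_push (g : T -> \bar R) :
  measurable_fun setT g -> (forall y, 0 <= g y) ->
  \int[push]_y g y = \int[P]_x g (f x).
Proof. by move=> mg g0; rewrite ge0_integral_pushforward. Qed.

End push.

Lemma continuous_borel (X Y : ptopologicalType) (f : X -> Y) :
  continuous f -> measurable_fun setT (f : borel X -> borel Y).
Proof.
move=> cf; apply: (@measurability _ _ (borel X) (borel Y) setT f (@open Y)) => //.
move=> _ [B oB <-]; rewrite setTI; apply: sub_sigma_algebra.
by move/continuousP: cf; exact.
Qed.

Lemma continuous_borel_real (R : realType) (X : ptopologicalType) (f : X -> R) :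
  continuous f -> measurable_fun setT (f : borel X -> R).
Proof.
move=> cf; apply: (measurability _ (RGenOInfty.measurableE R)) => //.
move=> _ [_ [x ->] <-]; rewrite setTI; apply: sub_sigma_algebra.
by move/continuousP: cf; apply; exact: interval_open.
Qed.

Section metric.
Context (R : realType).

Lemma ler_mdist_sub (X : metricType R) (x x' y y' : X) :
  `|mdist x y - mdist x' y'| <= mdist x x' + mdist y y'.
Proof.
have h (a b a' b' : X) : mdist a b - mdist a' b' <= mdist a a' + mdist b b'.
  rewrite lerBlDr (le_trans (metric_triangle _ a' _))// -addrA lerD2l.
  by rewrite addrC (le_trans (metric_triangle _ b' _))// lerD2l metric_sym.
by rewrite ler_norml h andbT lerNl opprB (le_trans (h _ _ _ _))//
  (metric_sym x') (metric_sym y').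
Qed.

Lemma continuous_mdist (X : metricType R) :
  continuous (fun z : X * X => mdist z.1 z.2 : R).
Proof.
move=> [x y]; apply/cvgrPdist_lt => e e0.
have e20 : 0 < e / 2 by rewrite divr_gt0.
have h1 : \forall z \near (x, y), mdist x z.1 < e / 2.
  exact: (metricType_numDomainType.cvgr_dist_lt
    (@cvg_fst _ _ (nbhs x) (nbhs y) _) e20).
have h2 : \forall z \near (x, y), mdist y z.2 < e / 2.
  exact: (metricType_numDomainType.cvgr_dist_lt
    (@cvg_snd _ _ (nbhs x) (nbhs y) _) e20).
apply: filterS2 h1 h2 => -[x' y'] /= xx' yy'.
by rewrite (le_lt_trans (ler_mdist_sub _ _ _ _))// [ltRHS]splitr ltrD.
Qed.

Lemma cvg_mdist (X : metricType R) T (F : set_system T) (FF : Filter F)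
    (f g : T -> X) (x y : X) :
  f @ F --> x -> g @ F --> y -> mdist (f t) (g t) @[t --> F] --> mdist x y.
Proof.
move=> fx gy; apply: (@cvg_comp _ _ _ (fun t => (f t, g t)) (fun z => mdist z.1 z.2) F
  (nbhs (x, y)) (nbhs (mdist x y))).
  exact: cvg_pair.
exact: (@continuous_mdist X (x, y)).
Qed.

End metric.

(** * Couplings and the distance from a measure to a point *)

Lemma integral_cst_probability d (T : measurableType d) (R : realType)
  (P : probability T R) (r : R) : (\int[P]_x (cst r%:E x) = r%:E)%E.
Proof. by rewrite integral_cst// [X in (_ * X)%E]probability_setT mule1. Qed.

Section cost.
Context (R : realType) (p : R) (p1 : 1 < p).
Local Open Scope ereal_scope.

Definition cost (X : pmetricType R) (Pi : probability (borel (X * X)%type) R) :=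
  \int[Pi]_z ((mdist z.1 z.2 `^ p)%R)%:E.

(** This is the Wasserstein distance from [mu] to the Dirac mass at [a].  In this
form the triangle inequalities below are instances of Minkowski's inequality,
and no gluing of couplings is involved. *)
Definition Lp_dist (X : pmetricType R) (mu : probability (borel X) R) (a : X) :=
  'N[mu]_(p%:E)[EFin \o (fun x : borel X => mdist x a)].

Let p0 : (0 < p)%R. Proof. exact: lt_trans p1. Qed.

Lemma Lnorm_EFinE d (T : measurableType d) (mu : {measure set T -> \bar R})
  (f : T -> R) : (forall x, 0 <= f x)%R ->
  'N[mu]_(p%:E)[EFin \o f] = (\int[mu]_x ((f x `^ p)%R)%:E) `^ p^-1.
Proof.
move=> f0; rewrite Lnorm.unlock.
apply: (congr1 (fun t => t `^ p^-1)).
apply: eq_integral => x _.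
by rewrite /= (ger0_norm (f0 x)).
Qed.

Lemma Lnorm_le_add d (T : measurableType d) (mu : {measure set T -> \bar R})
  (f g h : T -> R) :
  measurable_fun setT f -> measurable_fun setT g -> measurable_fun setT h ->
  (forall x, 0 <= f x <= g x + h x)%R ->
  'N[mu]_(p%:E)[EFin \o f] <=
  'N[mu]_(p%:E)[EFin \o g] + 'N[mu]_(p%:E)[EFin \o h].
Proof.
move=> mf mg mh fgh.
apply: le_trans (minkowski_EFin _ mg mh (ltW p1)).
have f0 x : (0 <= f x)%R by case/andP: (fgh x).
have gh0 x : (0 <= g x + h x)%R by case/andP: (fgh x) => /le_trans; apply.
rewrite (Lnorm_EFinE _ f0) (Lnorm_EFinE _ gh0); apply: gt0_ler_poweR.
- by rewrite invr_ge0 ltW.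
- by rewrite in_itv/= leey andbT integral_ge0// => x _; rewrite lee_fin powR_ge0.
- by rewrite in_itv/= leey andbT integral_ge0// => x _; rewrite lee_fin powR_ge0.
- apply: ge0_le_integral => //.
  + by move=> x _; rewrite lee_fin powR_ge0.
  + apply/measurable_EFinP; exact: (measurableT_comp (measurable_powR p)).
  + apply/measurable_EFinP; apply: (measurableT_comp (measurable_powR p)); exact: measurable_funD.
  + move=> x _; rewrite lee_fin ge0_ler_powR ?nnegrE ?(ltW p0)//=.
    by case/andP: (fgh x).
Qed.

Lemma Lnorm_cst d (T : measurableType d) (P : probability T R) (r : R) :
  (0 <= r)%R -> 'N[P]_(p%:E)[EFin \o cst r] = r%:E.
Proof.
move=> r0; rewrite Lnorm_EFinE//= (integral_cst_probability P (r `^ p)%R).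
by rewrite poweR_EFin -powRrM mulfV ?gt_eqF// powRr1.
Qed.

Lemma measurable_mdist (X : pmetricType R) :
  measurable_fun setT (fun z : borel (X * X)%type => mdist z.1 z.2 : R).
Proof. apply: continuous_borel_real; exact: continuous_mdist. Qed.

Lemma measurable_mdistl (X : pmetricType R) (a : X) :
  measurable_fun setT (fun x : borel X => mdist x a : R).
Proof.
apply: continuous_borel_real => x.
by apply: cvg_mdist; [exact: cvg_id|exact: cvg_cst].
Qed.

Lemma measurable_mdist_powR (X : pmetricType R) :
  measurable_fun setT
    (fun z : borel (X * X)%type => (mdist z.1 z.2 `^ p)%R%:E : \bar R).
Proof.
apply/measurable_EFinP; apply: (measurableT_comp (measurable_powR p)); exact: measurable_mdist.
Qed.

Lemma measurable_mdistl_powR (X : pmetricType R) (a : X) :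
  measurable_fun setT (fun x : borel X => (mdist x a `^ p)%R%:E : \bar R).
Proof.
apply/measurable_EFinP; apply: (measurableT_comp (measurable_powR p)); exact: measurable_mdistl.
Qed.

Lemma cost_ge0 (X : pmetricType R) (Pi : probability (borel (X * X)%type) R) : 
  0 <= cost Pi.
Proof. by apply: integral_ge0 => z _; rewrite lee_fin powR_ge0. Qed.

Section one_space.
Context (X : pmetricType R).
Implicit Types (mu nu : probability (borel X) R)
  (Pi : probability (borel (X * X)%type) R).

Lemma borel_fst : measurable_fun setT (fst : borel (X * X)%type -> borel X).
Proof. apply: continuous_borel => z; exact: cvg_fst. Qed.

Lemma borel_snd : measurable_fun setT (snd : borel (X * X)%type -> borel X).
Proof. apply: continuous_borel => z; exact: cvg_snd. Qed.

Lemma coupling_fst mu nu Pi (g : borel X -> \bar R) : coupling mu nu Pi ->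
  measurable_fun setT g -> (forall x, 0 <= g x) ->
  \int[Pi]_z g z.1 = \int[mu]_x g x.
Proof.
move=> c mg g0; rewrite -(integral_push borel_fst)//.
by apply: eq_measure_integral => A mA _; case: (c A mA).
Qed.

Lemma coupling_snd mu nu Pi (g : borel X -> \bar R) : coupling mu nu Pi ->
  measurable_fun setT g -> (forall x, 0 <= g x) ->
  \int[Pi]_z g z.2 = \int[nu]_x g x.
Proof.
move=> c mg g0; rewrite -(integral_push borel_snd)//.
by apply: eq_measure_integral => A mA _; case: (c A mA).
Qed.

Lemma coupling_Lp_dist_fst mu nu Pi a : coupling mu nu Pi ->
  'N[Pi]_(p%:E)[EFin \o (fun z => mdist z.1 a)] = Lp_dist mu a.
Proof.
move=> c; rewrite /Lp_dist !Lnorm_EFinE; try by move=> ?; exact: mdist_ge0.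
congr (_ `^ _); rewrite -(coupling_fst c)//.
  exact: measurable_mdistl_powR.
by move=> x; rewrite lee_fin powR_ge0.
Qed.

Lemma coupling_Lp_dist_snd mu nu Pi a : coupling mu nu Pi ->
  'N[Pi]_(p%:E)[EFin \o (fun z => mdist z.2 a)] = Lp_dist nu a.
Proof.
move=> c; rewrite /Lp_dist !Lnorm_EFinE; try by move=> ?; exact: mdist_ge0.
congr (_ `^ _); rewrite -(coupling_snd c)//.
  exact: measurable_mdistl_powR.
by move=> x; rewrite lee_fin powR_ge0.
Qed.

Lemma Lp_dist_ge0 mu a : 0 <= Lp_dist mu a.
Proof. exact: Lnorm_ge0. Qed.

Lemma Lp_dist_poweR mu a : Lp_dist mu a `^ p = \int[mu]_x ((mdist x a `^ p)%R)%:E.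
Proof.
rewrite /Lp_dist poweR_Lnorm; last by rewrite gt_eqF.
by apply: eq_integral => x _; rewrite /= (ger0_norm (mdist_ge0 x a)).
Qed.

Lemma Lp_dist_triangle mu a b : Lp_dist mu a <= Lp_dist mu b + (mdist a b)%:E.
Proof.
rewrite -(@Lnorm_cst _ _ mu) ?mdist_ge0//; apply: Lnorm_le_add.
- exact: measurable_mdistl.
- exact: measurable_mdistl.
- by [].
- by move=> x; rewrite mdist_ge0/= (metric_sym a) metric_triangle.
Qed.

Lemma mdist_le_Lp_dist mu a b : (mdist a b)%:E <= Lp_dist mu a + Lp_dist mu b.
Proof.
rewrite -(@Lnorm_cst _ _ mu) ?mdist_ge0//; apply: Lnorm_le_add.
- by [].
- exact: measurable_mdistl.
- exact: measurable_mdistl.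
- by move=> x; rewrite mdist_ge0/= (metric_sym x a) metric_triangle.
Qed.

Lemma Lp_dist_lty mu a : finite_moment p mu -> Lp_dist mu a < +oo.
Proof.
move=> [x0 fx0]; apply: le_lt_trans (Lp_dist_triangle mu a x0) _.
rewrite lte_add_pinfty ?ltry//.
rewrite /Lp_dist Lnorm_EFinE; last by move=> ?; exact: mdist_ge0.
exact: poweR_lty.
Qed.

Lemma wasserstein_dist_le (mu nu : wasserstein p X) Pi :
  coupling (sval mu) (sval nu) Pi ->
  wasserstein_dist mu nu <= (cost Pi) `^ p^-1.
Proof.
move=> c; apply: gt0_ler_poweR.
- by rewrite invr_ge0 ltW.
- rewrite in_itv/= leey andbT; apply: le_ereal_inf_tmp => _ [Q _ <-]; exact: cost_ge0.
- by rewrite in_itv/= leey andbT; exact: cost_ge0.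
- by apply: ereal_inf_lbound; exists Pi.
Qed.

Lemma le_wasserstein_dist (mu nu : wasserstein p X) (c : \bar R) : 0 <= c ->
  (forall Pi, coupling (sval mu) (sval nu) Pi -> c <= (cost Pi) `^ p^-1) ->
  c <= wasserstein_dist mu nu.
Proof.
move=> c0 h.
have -> : c = (c `^ p) `^ p^-1.
  by rewrite -poweRrM mulfV ?gt_eqF// poweRe1.
apply: gt0_ler_poweR.
- by rewrite invr_ge0 ltW.
- by rewrite in_itv/= leey andbT poweR_ge0.
- rewrite in_itv/= leey andbT; apply: le_ereal_inf_tmp => _ [Q _ <-]; exact: cost_ge0.
- apply: le_ereal_inf_tmp => _ [Q /h cQ <-].
  have -> : \int[Q]_z ((mdist z.1 z.2 `^ p)%R)%:E = ((cost Q) `^ p^-1) `^ p.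
    by rewrite -poweRrM mulVf ?gt_eqF// poweRe1//; exact: cost_ge0.
  apply: gt0_ler_poweR => //; first exact: ltW.
  by rewrite in_itv/= leey andbT.
  by rewrite in_itv/= leey andbT poweR_ge0.
Qed.

(** Minkowski's inequality under each coupling of [mu] and [nu]. *)
Lemma Lp_dist_le_wasserstein (mu nu : wasserstein p X) a :
  Lp_dist (sval mu) a <= wasserstein_dist mu nu + Lp_dist (sval nu) a.
Proof.
have nufin : Lp_dist (sval nu) a \is a fin_num.
  by rewrite ge0_fin_numE ?Lp_dist_ge0// Lp_dist_lty//; exact: svalP nu.
rewrite -leeBlDr//.
have [neg|pos] := leP (Lp_dist (sval mu) a - Lp_dist (sval nu) a) 0.
  by rewrite (le_trans neg)// poweR_ge0.
apply: le_wasserstein_dist (ltW pos) _ => Pi c.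
rewrite leeBlDr//.
rewrite -(coupling_Lp_dist_fst a c) -(coupling_Lp_dist_snd a c).
rewrite -(@Lnorm_EFinE _ _ Pi (fun z : borel (X * X)%type => mdist z.1 z.2));
  last by move=> z; exact: mdist_ge0.
apply: Lnorm_le_add.
- exact: (measurableT_comp (measurable_mdistl a) borel_fst).
- exact: measurable_mdist.
- exact: (measurableT_comp (measurable_mdistl a) borel_snd).
- by move=> z; rewrite mdist_ge0/= metric_triangle.
Qed.

Lemma mdist_le_wasserstein (mu nu : wasserstein p X) a b :
  (mdist a b)%:E <=
  Lp_dist (sval mu) a + wasserstein_dist mu nu + Lp_dist (sval nu) b.
Proof.
apply: le_trans (mdist_le_Lp_dist (sval mu) a b) _.
by rewrite -addeA leeD2l// Lp_dist_le_wasserstein.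
Qed.

Lemma Lp_dist_dirac (a b : X) :
  Lp_dist (\d_(a : borel X) : probability (borel X) R) b = (mdist a b)%:E.
Proof.
rewrite /Lp_dist Lnorm_EFinE; last by move=> ?; exact: mdist_ge0.
rewrite integral_dirac//; last exact: measurable_mdistl_powR.
rewrite diracT mul1e poweR_EFin -powRrM mulfV ?gt_eqF// powRr1//.
exact: mdist_ge0.
Qed.

Lemma finite_moment_dirac (a : X) :
  finite_moment p (\d_(a : borel X) : probability (borel X) R).
Proof.
exists a; rewrite integral_dirac//; last exact: measurable_mdistl_powR.
by rewrite diracT mul1e ltry.
Qed.

Definition wdirac (a : X) : wasserstein p X :=
  exist _ (\d_(a : borel X) : probability (borel X) R) (finite_moment_dirac a).

Lemma wasserstein_dist_dirac (a b : X) :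
  wasserstein_dist (wdirac a) (wdirac b) = (mdist a b)%:E.
Proof.
apply/eqP; rewrite eq_le; apply/andP; split; last first.
  have := mdist_le_wasserstein (wdirac a) (wdirac b) a b.
  by rewrite /= !Lp_dist_dirac !mdistxx add0e adde0.
pose Pi := (\d_((a, b) : borel (X * X)%type) : probability (borel (X * X)%type) R).
have c : coupling (sval (wdirac a)) (sval (wdirac b)) Pi.
  by move=> A mA; split; rewrite /= /dirac !indicE.
apply: le_trans (wasserstein_dist_le c) _.
rewrite /cost integral_dirac//; last exact: measurable_mdist_powR.
rewrite diracT mul1e poweR_EFin -powRrM mulfV ?gt_eqF// powRr1//.
exact: mdist_ge0.
Qed.

End one_space.

(** * Embeddings induced by retracts *)

Section embedding.
Context (X Y : pmetricType R) (iota : X -> Y) (r : Y -> X).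
Hypothesis iota_iso : forall x x', mdist (iota x) (iota x') = mdist x x'.
Hypothesis iotaK : cancel iota r.
Hypothesis r_cont : continuous r.

Let iota_cont : continuous iota.
Proof.
move=> x; apply/metricType_numDomainType.cvgrPdist_lt => e e0.
have h : \forall x' \near x, (mdist x x' < e)%R.
  exact: (metricType_numDomainType.cvgr_dist_lt (@cvg_id _ (nbhs x)) e0).
by apply: filterS h => x'; rewrite iota_iso.
Qed.

Let pair_cont (U V : pmetricType R) (f : U -> V) : continuous f ->
  continuous (fun z : U * U => (f z.1, f z.2)).
Proof.
move=> cf [a b]; apply: cvg_pair => /=.
  by apply: cvg_comp; [exact: cvg_fst|exact: cf].
by apply: cvg_comp; [exact: cvg_snd|exact: cf].
Qed.

Let m_iota := continuous_borel iota_cont.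
Let m_iota2 := continuous_borel (pair_cont iota_cont).
Let m_r := continuous_borel r_cont.
Let m_r2 := continuous_borel (pair_cont r_cont).

Let finite_moment_push (mu : wasserstein p X) :
  finite_moment p (push m_iota (sval mu)).
Proof.
case: mu => mu [x0 fx0] /=; exists (iota x0).
rewrite (integral_push m_iota _ (measurable_mdistl_powR (iota x0))).
  by under eq_integral do rewrite iota_iso.
by move=> y; rewrite lee_fin powR_ge0.
Qed.

Let wpush (mu : wasserstein p X) : wasserstein p Y := exist _ _ (finite_moment_push mu).

Let coupling_push (mu nu : wasserstein p X) Pi :
  coupling (sval mu) (sval nu) Pi ->
  coupling (sval (wpush mu)) (sval (wpush nu)) (push m_iota2 Pi).
Proof.
move=> c A mA.
have mA' : measurable (iota @^-1` A : set (borel X)).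
  by rewrite -[X in measurable X]setTI; exact: m_iota.
exact: c mA'.
Qed.

Let coupling_pull (mu nu : wasserstein p X) Pi :
  coupling (sval (wpush mu)) (sval (wpush nu)) Pi ->
  coupling (sval mu) (sval nu) (push m_r2 Pi).
Proof.
move=> c A mA.
have mA' : measurable (r @^-1` A : set (borel Y)).
  by rewrite -[X in measurable X]setTI; exact: m_r.
have e : iota @^-1` (r @^-1` A) = A.
  by apply/seteqP; split => x /=; rewrite iotaK.
have := c _ mA'; rewrite /= /distribution /pushforward/= e.
exact.
Qed.

Let cost_push Pi : cost (push m_iota2 Pi) = cost Pi.
Proof.
rewrite /cost integral_push; last 2 first.
- exact: measurable_mdist_powR.
- by move=> z; rewrite lee_fin powR_ge0.
by apply: eq_integral => z _ /=; rewrite iota_iso.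
Qed.

(** The fixed points of [iota \o r] form the image of [iota].  Both marginals are
carried by this closed set, hence [Pi] is carried by its square, on which [r]
preserves distances. *)
Let cost_pull (mu nu : wasserstein p X) Pi :
  coupling (sval (wpush mu)) (sval (wpush nu)) Pi ->
  cost (push m_r2 Pi) = cost Pi.
Proof.
move=> c; rewrite /cost integral_push; last 2 first.
- exact: measurable_mdist_powR.
- by move=> z; rewrite lee_fin powR_ge0.
pose I : set (borel Y) := [set y | iota (r y) = y].
have mI : measurable I.
  rewrite (_ : I = (fun y : borel Y => mdist (iota (r y)) y : R) @^-1` [set 0%R]).
    rewrite -[X in measurable X]setTI.
    apply: (continuous_borel_real (X := Y) (f := fun y => mdist (iota (r y)) y)) => //.
    move=> y; apply: cvg_mdist; last exact: cvg_id.
    by apply: cvg_comp; [exact: r_cont|exact: iota_cont].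
  by apply/seteqP; split => y /= => [->|]; [rewrite mdistxx|move/mdist_positivity].
have I1 : Pi (fst @^-1` (~` I)) = 0.
  have [-> _] := c _ (measurableC mI).
  rewrite /= /distribution /pushforward/= (_ : _ @^-1` _ = set0) ?measure0//.
  by apply/seteqP; split => x //=; rewrite /I /= iotaK.
have I2 : Pi (snd @^-1` (~` I)) = 0.
  have [_ ->] := c _ (measurableC mI).
  rewrite /= /distribution /pushforward/= (_ : _ @^-1` _ = set0) ?measure0//.
  by apply/seteqP; split => x //=; rewrite /I /= iotaK.
apply: ge0_ae_eq_integral => //.
- have := measurableT_comp (measurable_mdist_powR (X:=X)) m_r2; exact.
- exact: measurable_mdist_powR.
- by move=> z _; rewrite lee_fin powR_ge0.
- by move=> z _; rewrite lee_fin powR_ge0.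
have m1 : measurable (fst @^-1` (~` I) : set (borel (Y * Y)%type)).
  by rewrite -[X in measurable X]setTI; apply: borel_fst => //; exact: measurableC.
have m2 : measurable (snd @^-1` (~` I) : set (borel (Y * Y)%type)).
  by rewrite -[X in measurable X]setTI; apply: borel_snd => //; exact: measurableC.
exists (fst @^-1` (~` I) `|` snd @^-1` (~` I)); split.
- exact: measurableU.
- by apply: null_set_setU.
- move=> -[y y'] /= h; apply: contrapT => /not_orP[/= /contrapT yI /contrapT y'I].
  by apply: h => _; rewrite -iota_iso yI y'I.
Qed.

(** Push-forward and pull-back match the couplings of two measures with the
couplings of their images, with the same costs; the two infima are taken over
the same set of numbers. *)
Lemma embeds_of_retract : embeds_isometrically p X Y.
Proof.
exists wpush => mu nu; congr (ereal_inf _ `^ _); apply/seteqP.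
split => [_ [Pi c <-]|_ [Pi c <-]].
- by exists (push m_r2 Pi); [exact: coupling_pull|exact: cost_pull c].
- by exists (push m_iota2 Pi); [exact: coupling_push|exact: cost_push].
Qed.

End embedding.

Lemma embeds_trans (X Y Z : pmetricType R) :
  embeds_isometrically p X Y -> embeds_isometrically p Y Z ->
  embeds_isometrically p X Z.
Proof.
by move=> [f hf] [g hg]; exists (g \o f) => mu nu /=; rewrite hg hf.
Qed.

End cost.

(** * Product couplings on separable spaces *)

Section product_probability.
Context d1 d2 (S : measurableType d1) (T : measurableType d2) (R : realType).
Variables (mu : probability S R) (nu : probability T R).
Local Open Scope ereal_scope.

Let prod := mu \x nu.

HB.instance Definition _ := Measure.on prod.

Let prodT : prod [set: S * T] = 1.
Proof.
rewrite -setXTT [LHS]product_measure1E//.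
by rewrite [X in X * _]probability_setT [X in _ * X]probability_setT mule1.
Qed.

HB.instance Definition _ := Measure_isProbability.Build _ _ _ prod prodT.

Definition product_probability : probability (S * T)%type R := prod.
End product_probability.

Section separable.
Context (R : realType) (p : R) (p1 : 1 < p) (X : pmetricType R).
Context (I : countType) (D : I -> X).
Hypothesis D_dense : forall (x : X) (e : R), 0 < e -> exists i, mdist (D i) x < e.

Let p0 : (0 < p)%R. Proof. exact: lt_trans p1. Qed.

(** Separability makes every open subset of [X * X] a countable union of products
of balls.  The product measure is thereby defined on the Borel sets of the
product topology, where couplings live. *)
Lemma measurable_prod_borel :
  measurable_fun setT (id : (borel X * borel X)%type -> borel (X * X)%type).
Proof.
apply: (@measurability _ _ (borel X * borel X)%type (borel (X * X)%type)
  setT _ (@open (X * X)%type)) => //.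
move=> _ [U oU <-]; rewrite setTI preimage_id.
have mball (a : X) (e : R) : measurable (ball a e : set (borel X)).
  rewrite ballEmdist (_ : [set y | mdist a y < e] =
    (fun x : borel X => mdist x a : R) @^-1` `]-oo, e[); last first.
    by apply/seteqP; split => x /=; rewrite in_itv/= metric_sym.
  by rewrite -[X in measurable X]setTI; exact: measurable_mdistl.
pose B (t : I * I * nat) : set (X * X) :=
  ball (D t.1.1) (t.2.+1%:R^-1) `*` ball (D t.1.2) (t.2.+1%:R^-1).
pose F t := if pselect (B t `<=` U) is left _ then B t else set0.
have -> : U = \bigcup_t F t.
  apply/seteqP; split => [[x y] Uxy|xy [t _]]; last first.
    by rewrite /F; case: pselect => //; apply.
  have [[P Q] /= [Px Qy] PQU] := open_nbhs_nbhs (conj oU Uxy).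
  have /nbhs_ballP[e1 /= e10 xe1] := Px.
  have /nbhs_ballP[e2 /= e20 ye2] := Qy.
  pose e := Num.min e1 e2; have e0 : 0 < e by rewrite lt_min e10.
  have [m me] : exists m, (m.+1%:R^-1 < e / 2 :> R).
    have [m _ hm] := near_infty_natSinv_lt (PosNum (divr_gt0 e0 (ltr0Sn R 1))).
    by exists m; apply: hm => /=.
  have m0 : 0 < m.+1%:R^-1 :> R by rewrite invr_gt0.
  have [i ix] := D_dense x m0.
  have [j jy] := D_dense y m0.
  exists (i, j, m) => //; rewrite /F; case: pselect => [_|].
    by split; rewrite /= ballEmdist.
  case=> -[x' y'] [/= ]; rewrite !ballEmdist /= => ix' jy'; apply: PQU; split => /=.
    apply: xe1; rewrite ballEmdist /=; apply: le_lt_trans (metric_triangle _ (D i) _) _.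
    have : e <= e1 by rewrite ge_min lexx.
    by move/(lt_le_trans _); apply; rewrite metric_sym [ltRHS]splitr ltrD// (lt_trans _ me).
  apply: ye2; rewrite ballEmdist /=; apply: le_lt_trans (metric_triangle _ (D j) _) _.
  have : e <= e2 by rewrite ge_min lexx orbT.
  by move/(lt_le_trans _); apply; rewrite metric_sym [ltRHS]splitr ltrD// (lt_trans _ me).
apply: countable_bigcupT_measurable => // t.
rewrite /F; case: pselect => // _; exact: measurableX.
Qed.

Local Open Scope ereal_scope.

Section product_coupling.
Variables (mu nu : probability (borel X) R).

Definition product_coupling : probability (borel (X * X)%type) R :=
  push measurable_prod_borel (product_probability mu nu).

Lemma coupling_product : coupling mu nu product_coupling.
Proof.
move=> A mA; split.
  rewrite /product_coupling /= /distribution /pushforward /=.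
  rewrite (_ : _ @^-1` _ = A `*` setT); last first.
    by apply/seteqP; split => [[x y] //=|[x y] [//]].
  rewrite [LHS]product_measure1E// [X in _ * X](_ : _ = 1) ?mule1//.
  exact: probability_setT.
rewrite /product_coupling /= /distribution /pushforward /=.
rewrite (_ : _ @^-1` _ = setT `*` A); last first.
  by apply/seteqP; split => [[x y] //=|[x y] [//]].
rewrite [LHS]product_measure1E// [X in X * _](_ : _ = 1) ?mul1e//.
exact: probability_setT.
Qed.

Lemma cost_product : cost p product_coupling =
  \int[nu]_y \int[mu]_x ((mdist x y `^ p)%R)%:E.
Proof.
rewrite /cost integral_push; last 2 first.
- exact: measurable_mdist_powR.
- by move=> z; rewrite lee_fin powR_ge0.
rewrite [LHS](fubini_tonelli2 (fun z : (borel X * borel X)%type =>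
  ((@mdist R X z.1 z.2 `^ p)%R)%:E))//.
- have := measurableT_comp (measurable_mdist_powR p (X:=X)) measurable_prod_borel.
  exact.
- by move=> z; rewrite lee_fin powR_ge0.
Qed.

End product_coupling.

(** Minkowski's inequality under the product coupling. *)
Lemma wasserstein_le_Lp_dist (mu nu : wasserstein p X) a :
  wasserstein_dist mu nu <= Lp_dist p (sval mu) a + Lp_dist p (sval nu) a.
Proof.
pose c := coupling_product (sval mu) (sval nu).
apply: le_trans (wasserstein_dist_le p1 c) _.
rewrite -(coupling_Lp_dist_fst p a c) -(coupling_Lp_dist_snd p a c).
rewrite -(@Lnorm_EFinE _ p _ _ _ (fun z : borel (X * X)%type => mdist z.1 z.2));
  last by move=> z; exact: mdist_ge0.
apply: Lnorm_le_add => //.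
- exact: measurable_mdist.
- exact: (measurableT_comp (measurable_mdistl a) (borel_fst (X:=X))).
- exact: (measurableT_comp (measurable_mdistl a) (borel_snd (X:=X))).
- by move=> z; rewrite mdist_ge0/= (metric_sym z.2 a) metric_triangle.
Qed.

(** The pointwise hypothesis says that [u] is close to [s v] unless [mdist u v]
falls short of its maximum.  The product coupling costs at least [w `^ p];
integrating the hypothesis against it bounds by [2 * L * M `^ p - K * w `^ p]
the average over [v] of the p-th power of the distance from [mu] to [s v], so
some [c = s v] does at least as well as the average. *)
Lemma concentration (s : X -> X) (o : X) (K L M w B : R)
  (mu nu : wasserstein p X) : (0 <= K)%R -> (0 <= L)%R -> (0 <= w)%R -> (0 <= B)%R ->
  (forall u v, mdist u (s v) `^ p + K * mdist u v `^ p <=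
     L * (mdist u o `^ p + mdist v o `^ p))%R ->
  Lp_dist p (sval mu) o <= M%:E -> Lp_dist p (sval nu) o <= M%:E ->
  w%:E <= wasserstein_dist mu nu ->
  (2 * L * M `^ p - K * w `^ p < B)%R ->
  exists c, Lp_dist p (sval mu) c `^ p <= B%:E.
Proof.
move=> K0 L0 w0 B0 h muM nuM wW hB.
have M0 : (0 <= M)%R.
  by rewrite -lee_fin (le_trans _ muM)// Lp_dist_ge0.
have momM (m : wasserstein p X) : Lp_dist p (sval m) o <= M%:E ->
    \int[sval m]_x ((mdist x o `^ p)%R)%:E <= (M `^ p)%:E.
  move=> mM; rewrite -Lp_dist_poweR// -poweR_EFin; apply: gt0_ler_poweR => //.
  - exact: ltW.
  - by rewrite in_itv/= leey andbT Lp_dist_ge0.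
  - by rewrite in_itv/= leey andbT lee_fin.
have costw : (w `^ p)%:E <= cost p (product_coupling (sval mu) (sval nu)).
  have := le_trans wW (wasserstein_dist_le p1 (coupling_product (sval mu) (sval nu))).
  move/(gt0_ler_poweR (ltW p0)).
  rewrite -poweRrM mulVf ?gt_eqF// poweRe1; last exact: cost_ge0.
  apply; first by rewrite in_itv/= leey andbT lee_fin.
  by rewrite in_itv/= leey andbT poweR_ge0.
apply: contrapT => /forallNP nc.
have {}nc c : B%:E <= \int[sval mu]_x ((mdist x c `^ p)%R)%:E.
  by rewrite -Lp_dist_poweR//; have /negP := nc c; rewrite -ltNge => /ltW.
have mC := @measurable_mdistl_powR R p X.
have pos (c x : X) : 0 <= ((mdist x c `^ p)%R)%:E by rewrite lee_fin powR_ge0.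
have mB : measurable_fun setT (cst B%:E : borel X -> \bar R) by [].
have mD : measurable_fun setT (fun y : borel X =>
    \int[sval mu]_x ((mdist x y `^ p)%R)%:E).
  apply: (measurable_fun_fubini_tonelli_G (m1 := sval mu)
    (fun z : (borel X * borel X)%type => ((@mdist R X z.1 z.2 `^ p)%R)%:E)).
    have := measurableT_comp (measurable_mdist_powR p (X:=X)) measurable_prod_borel.
    exact.
  by move=> z; rewrite lee_fin powR_ge0.
have intpos (m : probability (borel X) R) c : 0 <= \int[m]_x ((mdist x c `^ p)%R)%:E.
  by apply: integral_ge0 => x _; exact: pos.
have slice y : B%:E + K%:E * \int[sval mu]_x ((mdist x y `^ p)%R)%:E <=
    (L * M `^ p)%:E + L%:E * ((mdist y o `^ p)%R)%:E.
  apply: (@le_trans _ _ (\int[sval mu]_x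
      (((mdist x (s y) `^ p)%R)%:E + K%:E * ((mdist x y `^ p)%R)%:E))).
    rewrite ge0_integralD//; last 2 first.
    - by move=> x _; rewrite mule_ge0// lee_fin.
    - exact: measurable_funeM.
    by rewrite ge0_integralZl// leeD.
  apply: (@le_trans _ _ (\int[sval mu]_x
      (L%:E * ((mdist x o `^ p)%R)%:E + cst (L * mdist y o `^ p)%:E x))).
    apply: ge0_le_integral => //.
    - by move=> x _; rewrite adde_ge0// mule_ge0// lee_fin.
    - by apply: emeasurable_funD => //; exact: measurable_funeM.
    - by apply: emeasurable_funD => //; exact: measurable_funeM.
    - by move=> x _; rewrite lee_fin -mulrDr; exact: h.
  rewrite ge0_integralD//; last 3 first.
  - by move=> x _; rewrite mule_ge0// lee_fin.
  - exact: measurable_funeM.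
  - by move=> x _; rewrite lee_fin mulr_ge0// powR_ge0.
  rewrite ge0_integralZl// integral_cst_probability.
  by rewrite !EFinM leeD2r// lee_wpmul2l ?lee_fin// momM.
have : \int[sval nu]_y (B%:E + K%:E * \int[sval mu]_x ((mdist x y `^ p)%R)%:E) <=
    \int[sval nu]_y ((L * M `^ p)%:E + L%:E * ((mdist y o `^ p)%R)%:E).
  apply: ge0_le_integral => //.
  - by move=> x _; rewrite adde_ge0 ?lee_fin// mule_ge0// lee_fin.
  - by apply: emeasurable_funD => //; exact: measurable_funeM.
  - by apply: emeasurable_funD => //; exact: measurable_funeM.
rewrite ge0_integralD//; last 2 first.
- by move=> x _; rewrite mule_ge0// lee_fin.
- exact: measurable_funeM.
rewrite ge0_integralD//; last 3 first.
- by move=> x _; rewrite lee_fin mulr_ge0// powR_ge0.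
- by move=> x _; rewrite mule_ge0// lee_fin.
- exact: measurable_funeM.
rewrite !ge0_integralZl// !integral_cst_probability -cost_product.
have : (B + K * w `^ p)%:E <=
    B%:E + K%:E * cost p (product_coupling (sval mu) (sval nu)).
  by rewrite EFinD EFinM leeD2l// lee_wpmul2l ?lee_fin.
move=> h1 /(le_trans h1) h2.
have : (L * M `^ p)%:E + L%:E * \int[sval nu]_x ((mdist x o `^ p)%R)%:E <=
    (L * M `^ p + L * M `^ p)%:E.
  by rewrite EFinD leeD2l// EFinM lee_wpmul2l ?lee_fin// momM.
move=> /(le_trans h2); rewrite lee_fin; apply/negP; rewrite -ltNge; lra.
Qed.

End separable.

(** * Near-equality in the power mean inequality *)

Section ultralimits.
Context (R : realType) (U : set_system nat) {UU : UltraFilter U}.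

(** Limits along one fixed ultrafilter exist simultaneously for all bounded
sequences; they replace the extraction of subsequences. *)
Lemma ultra_cvg_bounded (x : nat -> R) (M : R) :
  (forall n, `|x n| <= M) -> exists l : R, x @ U --> l.
Proof.
move=> xM.
have : compact (`[(- M), M]%classic : set R) by exact: segment_compact.
move=> /(_ (x @ U) _ _)[].
  by apply: nearW => n /=; rewrite in_itv/= -ler_norml.
move=> l [_ xl]; exists l => A Al.
have [//|UA] := in_ultra_setVsetC (x @^-1` A) UU.
by have [y [/= nA yA]] := xl (~` A) A UA Al.
Qed.

End ultralimits.

Lemma cvg_exprn (R : realType) T (F : set_system T) {FF : Filter F}
    (x : T -> R) (l : R) n :
  x @ F --> l -> x t ^+ n @[t --> F] --> l ^+ n.
Proof.
move=> xl; elim: n => [|n IH]; first by rewrite expr0; apply: cvg_cst.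
by rewrite exprS; under eq_fun do rewrite exprS; exact: cvgM.
Qed.

Section powR_convexity.
Context (R : realType) (p : R) (p1 : 1 < p).

(** Strict Bernoulli inequality.  With [x = expR t], it follows from
[1 + (p - 1) * t < expR ((p - 1) * t)], multiplied by [expR t], and from
[1 - t <= expR (- t)]. *)
Lemma bernoulli_powR (x : R) : 0 <= x -> x != 1 -> 1 + p * (x - 1) < x `^ p.
Proof.
rewrite le_eqVlt => /predU1P[<-|x0].
  by move=> _; rewrite powR0 ?gt_eqF ?(lt_trans _ p1)// sub0r mulrN1 subr_lt0.
move=> x1; set t := ln x.
have xE : x = expR t by rewrite lnK ?posrE.
have xpE : x `^ p = expR t * expR ((p - 1) * t).
  by rewrite /powR gt_eqF// -expRD; congr expR; rewrite /t; ring.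
have e0 : 0 < expR t by exact: expR_gt0.
have h1 : expR t * (1 - t) <= 1.
  rewrite -[leRHS](expRxMexpNx_1 t) ler_pM2l//; exact: expR_ge1Dx.
have t0 : t != 0 by apply: contra_neq x1 => t0; rewrite xE t0 expR0.
have h2 : 1 + (p - 1) * t < expR ((p - 1) * t).
  by apply: expR_gt1Dx; rewrite mulf_neq0// subr_eq0 gt_eqF.
rewrite xpE; apply: (@le_lt_trans _ _ (expR t * (1 + (p - 1) * t))); last first.
  by rewrite ltr_pM2l.
rewrite {1}xE -subr_ge0.
have -> : expR t * (1 + (p - 1) * t) - (1 + p * (expR t - 1)) =
  (p - 1) * (1 - expR t * (1 - t)) by ring.
by rewrite mulr_ge0 ?subr_ge0// ltW.
Qed.

(** Strict convexity of the p-th power: add the strict Bernoulli inequalities at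
[a] and [b], both divided by their mean. *)
Lemma powR_midpoint_eq (a b : R) : 0 <= a -> 0 <= b ->
  2 `^ (p - 1) * (a `^ p + b `^ p) <= (a + b) `^ p -> a = b.
Proof.
move=> a0 b0 h.
have [ab0|abn0] := eqVneq (a + b) 0.
  by move: ab0; lra.
have ab_gt0 : 0 < a + b by rewrite lt_neqAle eq_sym abn0 addr_ge0.
set m := (a + b) / 2; have m0 : 0 < m by rewrite divr_gt0.
set x := a / m; set y := b / m.
have x0 : 0 <= x by rewrite divr_ge0// ltW.
have y0 : 0 <= y by rewrite divr_ge0// ltW.
have aE : a = m * x by rewrite /x mulrC divfK ?gt_eqF.
have bE : b = m * y by rewrite /y mulrC divfK ?gt_eqF.
have xy : x + y = 2.
  by rewrite /x /y -mulrDl /m invf_div mulrCA mulfV ?gt_eqF ?mulr1.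
have mp0 : 0 < m `^ p by rewrite powR_gt0.
have two : 2 `^ p = 2 * 2 `^ (p - 1) :> R by rewrite mulr_powRB1// (lt_trans _ p1).
have t0 : 0 < 2 `^ (p - 1) :> R by rewrite powR_gt0.
have : x `^ p + y `^ p <= 2.
  have ap : a `^ p = m `^ p * x `^ p by rewrite {1}aE powRM// ltW.
  have bp : b `^ p = m `^ p * y `^ p by rewrite {1}bE powRM// ltW.
  have abp : (a + b) `^ p = 2 * 2 `^ (p - 1) * m `^ p.
    by rewrite -two -powRM ?ltW//; congr (_ `^ _); rewrite /m; lra.
  move: h; rewrite ap bp abp -mulrDr.
  rewrite (_ : 2 * _ * _ = 2 `^ (p - 1) * (m `^ p * 2)); last by ring.
  by rewrite ler_pM2l// ler_pM2l.
have [x1 _|x1] := eqVneq x 1.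
  have y1 : y = 1 by move: xy; rewrite x1; lra.
  by rewrite aE bE x1 y1.
have y1 : y != 1 by apply: contra_neq x1 => y1; move: xy; rewrite y1; lra.
have := ltrD (bernoulli_powR x0 x1) (bernoulli_powR y0 y1).
have -> : 1 + p * (x - 1) + (1 + p * (y - 1)) = 2 + p * (x + y - 2) by ring.
by rewrite xy subrr mulr0 addr0 => /lt_le_trans /[apply]; rewrite ltxx.
Qed.

(** The reverse strict inequality would give [a = b] by [powR_midpoint_eq], where
the two sides agree. *)
Lemma powR_convex_le (a b : R) : 0 <= a -> 0 <= b ->
  (a + b) `^ p <= 2 `^ (p - 1) * (a `^ p + b `^ p).
Proof.
move=> a0 b0; rewrite leNgt; apply/negP => /[dup] /ltW.
move=> /(powR_midpoint_eq a0 b0) <-.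
have -> : a + a = 2 * a by ring.
have -> : 2 `^ (p - 1) * (a `^ p + a `^ p) = 2 * 2 `^ (p - 1) * a `^ p by ring.
by rewrite mulr_powRB1 ?(lt_trans _ p1)// powRM// ltxx.
Qed.

Lemma cvg_powR T (F : set_system T) {FF : ProperFilter F} (x : T -> R) (l : R) :
  (forall t, 0 <= x t) -> x @ F --> l -> x t `^ p @[t --> F] --> l `^ p.
Proof.
move=> x0 xl.
have l0 : 0 <= l by apply: (cvgr_to_ge xl); exact: nearW.
move: l0; rewrite le_eqVlt => /predU1P[l0|l0].
  rewrite -l0 powR0 ?gt_eqF ?(lt_trans _ p1)//.
  apply/cvgrPdist_le => e e0.
  have := xl; rewrite -l0 => /cvgrPdist_le => xl0.
  have m0 : 0 < Num.min e 1 by rewrite lt_min e0 ltr01.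
  apply: filterS (xl0 _ m0) => t.
  rewrite !sub0r !normrN !ger0_norm ?powR_ge0// le_min => /andP[xe x1].
  apply: le_trans xe; rewrite -[leRHS](powRr1 (x0 t)).
  have [->|xt] := eqVneq (x t) 0.
    by rewrite !powR0 ?oner_eq0// gt_eqF// (lt_trans _ p1).
  rewrite powRr1//; apply: ge1r_powR (ltW p1).
  by rewrite x1 andbT lt_neqAle eq_sym xt x0.
have cont : {for l, continuous (fun y : R => y `^ p)}.
  apply: differentiable_continuous; apply/derivable1_diffP.
  by have [] := is_derive1_powR p l0.
exact: (cvg_comp x _ xl cont).
Qed.

(** Here [a] and [b] stand for the distances of two points [u] and [v] to the
origin, [d] for the distance from [u] to [v], and [e] for the distance from [u]
to the inverse of [v]; [heis_dist_parallelogram] is the last constraint on them.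
If no [K] worked, normalized counterexamples for [K] going to infinity would have a
limit with [d] at least the power mean bound.  Strict convexity then gives
[a = b] and [d = a + b], the last constraint gives [e = 0], whereas [e `^ p] is
at least [eta] along the sequence. *)
Lemma near_equality (eta : R) : 0 < eta -> exists2 K : R, 0 <= K &
  forall a b d e : R, 0 <= a -> 0 <= b -> 0 <= d -> 0 <= e ->
    d <= a + b -> e <= a + b -> d ^+ 4 + e ^+ 4 / 2 <= 8 * (a ^+ 4 + b ^+ 4) ->
  e `^ p + K * d `^ p <= (eta + K * 2 `^ (p - 1)) * (a `^ p + b `^ p).
Proof.
move=> eta0; apply: contrapT => /forall2NP nK.
have p0 : 0 < p by exact: lt_trans p1.
have {}nK (m : nat) : exists q : R * R * R * R,
  [/\ 0 <= q.1.1.1, 0 <= q.1.1.2, 0 <= q.1.2 & 0 <= q.2] /\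
  [/\ q.1.2 <= q.1.1.1 + q.1.1.2, q.2 <= q.1.1.1 + q.1.1.2,
    q.1.2 ^+ 4 + q.2 ^+ 4 / 2 <= 8 * (q.1.1.1 ^+ 4 + q.1.1.2 ^+ 4) ,
    q.1.1.1 `^ p + q.1.1.2 `^ p = 1 &
    eta + m.+1%:R * 2 `^ (p - 1) < q.2 `^ p + m.+1%:R * q.1.2 `^ p].
  have [/negP|/existsNP[a /existsNP[b /existsNP[d /existsNP[e]]]]] := nK m.+1%:R.
    by rewrite ler0n.
  move=> /not_implyP[a0 /not_implyP[b0 /not_implyP[d0 /not_implyP[e0]]]].
  move=> /not_implyP[dab /not_implyP[eab /not_implyP[h]]] /negP; rewrite -ltNge => hh.
  (* all constraints are homogeneous: normalize the sum of p-th powers to 1 *)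
  set S := a `^ p + b `^ p.
  have S0 : 0 < S.
    rewrite lt_neqAle addr_ge0 ?powR_ge0// andbT eq_sym paddr_eq0 ?powR_ge0//.
    apply/negP; rewrite !powR_eq0 => /andP[/andP[/eqP a00 _] /andP[/eqP b00 _]].
    have d00 : d = 0 by lra.
    have e00 : e = 0 by lra.
    by move: hh; rewrite a00 b00 d00 e00 !powR0 ?gt_eqF// !(addr0,mulr0) ltxx.
  set r := (S `^ p^-1)^-1.
  have r0 : 0 < r by rewrite invr_gt0 powR_gt0.
  have rp : r `^ p = S^-1.
    by rewrite /r -powRN -powRrM mulNr mulVf ?gt_eqF// powRN powRr1// ltW.
  exists (r * a, r * b, r * d, r * e) => /=; split; first by split; rewrite mulr_ge0 ?(ltW r0).
  split.
  - by rewrite -mulrDr ler_pM2l.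
  - by rewrite -mulrDr ler_pM2l.
  - have -> : (r * d) ^+ 4 + (r * e) ^+ 4 / 2 = r ^+ 4 * (d ^+ 4 + e ^+ 4 / 2) by ring.
    have -> : 8 * ((r * a) ^+ 4 + (r * b) ^+ 4) = r ^+ 4 * (8 * (a ^+ 4 + b ^+ 4)) by ring.
    by rewrite ler_pM2l ?exprn_gt0.
  - by rewrite !powRM ?(ltW r0)// -mulrDr rp mulVf// gt_eqF.
  - rewrite !powRM ?(ltW r0)// rp.
    have -> : S^-1 * e `^ p + m.+1%:R * (S^-1 * d `^ p) = (e `^ p + m.+1%:R * d `^ p) / S by ring.
    by rewrite ltr_pdivlMr.
have [q hq] := choice nK.
have [U [UU oU]] := ultraFilterLemma eventually_filter.
have UP := @ultra_proper _ _ UU.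
have le1 (x y : R) : 0 <= x -> x `^ p + y `^ p = 1 -> x <= 1.
  move=> x0 xy; rewrite leNgt; apply/negP => x1.
  have : x `^ p <= 1 by rewrite -xy lerDl powR_ge0.
  by rewrite leNgt (lt_le_trans x1)// le1r_powR// ltW.
have bnd m (x : R) : 0 <= x -> x <= (q m).1.1.1 + (q m).1.1.2 -> `|x| <= 2.
  have [[a0 b0 _ _] [_ _ _ ab1 _]] := hq m => x0 xab.
  have a1 := le1 _ _ a0 ab1; have b1 : (q m).1.1.2 <= 1.
    by apply: (le1 _ (q m).1.1.1) => //; rewrite addrC.
  by rewrite ger0_norm// (le_trans xab)// (_ : 2 = 1 + 1)// lerD.
have [a ca] : exists a : R, (q m).1.1.1 @[m --> U] --> a.
  apply: (@ultra_cvg_bounded _ _ _ _ 2) => m; have [[a0 b0 _ _] _] := hq m.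
  by apply: (bnd m) => //; rewrite lerDl.
have [b cb] : exists b : R, (q m).1.1.2 @[m --> U] --> b.
  apply: (@ultra_cvg_bounded _ _ _ _ 2) => m; have [[a0 b0 _ _] _] := hq m.
  by apply: (bnd m) => //; rewrite lerDr.
have [d cd] : exists d : R, (q m).1.2 @[m --> U] --> d.
  apply: (@ultra_cvg_bounded _ _ _ _ 2) => m.
  by have [[_ _ d0 _] [dab _ _ _ _]] := hq m; exact: (bnd m).
have [e ce] : exists e : R, (q m).2 @[m --> U] --> e.
  apply: (@ultra_cvg_bounded _ _ _ _ 2) => m.
  by have [[_ _ _ e0] [_ eab _ _ _]] := hq m; exact: (bnd m).
have qa m : 0 <= (q m).1.1.1 by have [[]] := hq m.
have qb m : 0 <= (q m).1.1.2 by have [[]] := hq m.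
have qd m : 0 <= (q m).1.2 by have [[]] := hq m.
have qe m : 0 <= (q m).2 by have [[]] := hq m.
have a0 : 0 <= a by apply: (cvgr_to_ge ca); exact: nearW.
have b0 : 0 <= b by apply: (cvgr_to_ge cb); exact: nearW.
have d0 : 0 <= d by apply: (cvgr_to_ge cd); exact: nearW.
have e0 : 0 <= e by apply: (cvgr_to_ge ce); exact: nearW.
have cap : (q m).1.1.1 `^ p @[m --> U] --> a `^ p by exact: cvg_powR.
have cbp : (q m).1.1.2 `^ p @[m --> U] --> b `^ p by exact: cvg_powR.
have cdp : (q m).1.2 `^ p @[m --> U] --> d `^ p by exact: cvg_powR.
have cep : (q m).2 `^ p @[m --> U] --> e `^ p by exact: cvg_powR.
have ab1 : a `^ p + b `^ p = 1.
  have q1 m : (q m).1.1.1 `^ p + (q m).1.1.2 `^ p = 1 by have [_ []] := hq m.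
  have cab : (q m).1.1.1 `^ p + (q m).1.1.2 `^ p @[m --> U] --> a `^ p + b `^ p.
    exact: cvgD.
  by apply: le_anti; apply/andP; split; [apply: (cvgr_to_le cab)|apply: (cvgr_to_ge cab)];
    apply: nearW => m; have := q1 m => /= <-.
have dab : d <= a + b.
  by apply: (ler_cvg_to cd (cvgD ca cb)); apply: nearW => m; have [_ []] := hq m.
have h4 : d ^+ 4 + e ^+ 4 / 2 <= 8 * (a ^+ 4 + b ^+ 4).
  have cl : (q m).1.2 ^+ 4 + (q m).2 ^+ 4 / 2 @[m --> U] --> d ^+ 4 + e ^+ 4 / 2.
    by apply: cvgD; [|apply: cvgM; [|exact: cvg_cst]]; exact: cvg_exprn.
  have cr : 8 * ((q m).1.1.1 ^+ 4 + (q m).1.1.2 ^+ 4) @[m --> U] -->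
      8 * (a ^+ 4 + b ^+ 4).
    by apply: cvgM; [exact: cvg_cst|apply: cvgD; exact: cvg_exprn].
  by apply: (ler_cvg_to cl cr); apply: nearW => m; have [_ []] := hq m.
have two : 2 `^ p = 2 * 2 `^ (p - 1) :> R by rewrite mulr_powRB1.
have ep_le (m : nat) : (q m).2 `^ p <= 2 `^ p.
  have [[_ _ _ qe0] [_ qeab _ _ _]] := hq m.
  apply: ge0_ler_powR; rewrite ?nnegrE ?(ltW p0)//.
  by have := bnd m _ qe0 qeab; rewrite ger0_norm.
(* the violated inequality, divided by m.+1, bounds d `^ p below up to O(1 / m) *)
have dp : 2 `^ (p - 1) <= d `^ p.
  have harm : (fun m => m.+1%:R^-1 : R) @ U --> (0 : R).
    exact: cvg_trans (cvg_app _ oU) (@cvg_harmonic R).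
  have cdh : (q m).1.2 `^ p + 2 `^ p * m.+1%:R^-1 @[m --> U] --> d `^ p.
    rewrite -[X in _ --> X]addr0 -[X in _ --> _ + X](mulr0 (2 `^ p)).
    by apply: cvgD => //; apply: cvgM => //; exact: cvg_cst.
  apply: (cvgr_to_ge cdh); apply: nearW => m /=; have [_ [_ _ _ _ hm]] := hq m.
  have m0 : 0 < m.+1%:R :> R by [].
  rewrite -(ler_pM2l m0) mulrDr mulrCA mulfV ?gt_eqF// mulr1.
  have := ep_le m; lra.
have ab : a = b.
  apply: powR_midpoint_eq => //; rewrite ab1 mulr1 (le_trans dp)//.
  by apply: ge0_ler_powR; rewrite ?nnegrE ?(ltW p0)// addr_ge0.
have dE : d = a + b.
  apply/eqP; rewrite eq_le dab leNgt; apply/negP => dlt.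
  have : d `^ p < (a + b) `^ p by apply: gt0_ltr_powR; rewrite ?nnegrE// addr_ge0.
  rewrite ltNge => /negP; apply; apply: le_trans dp.
  rewrite -ab (_ : a + a = 2 * a); last by ring.
  rewrite powRM// two mulrAC -[leRHS]mul1r ler_wpM2r ?powR_ge0//.
  by move: ab1; rewrite -ab; lra.
have e00 : e = 0.
  have : e ^+ 4 <= 0 by move: h4; rewrite dE -ab; lra.
  have : 0 <= e ^+ 4 by rewrite exprn_ge0.
  by move=> h1 h2; apply/eqP; move: (eq_le (e ^+ 4) 0); rewrite h1 h2 expf_eq0.
have : eta <= e `^ p.
  apply: (cvgr_to_ge cep); apply: nearW => m; have [[qa0 qb0 qd0 _] [qdab _ _ q1 hm]] := hq m.
  (* with this bound the violated inequality leaves eta < (q m).2 `^ p *)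
  have : (q m).1.2 `^ p <= 2 `^ (p - 1).
    have := powR_convex_le qa0 qb0; rewrite q1 mulr1; apply: le_trans.
    by apply: ge0_ler_powR; rewrite ?nnegrE ?(ltW p0)// addr_ge0.
  move=> h; have m0 : 0 < m.+1%:R :> R by [].
  by move: h; rewrite -(ler_pM2l m0); lra.
by rewrite e00 powR0 ?gt_eqF// leNgt eta0.
Qed.

End powR_convexity.

(** * Geometry of the Koranyi distance *)

Section geometry.
Context (R : realType) (n : nat).
Notation H := (heisenberg R n).
Implicit Types (g h : H) (x y : 'rV[R]_n).

(** [hdot] and [hsymp] are, up to sign, the real and the imaginary part of the
Hermitian product of the horizontal components, seen in C^n. *)
Definition hdot g h : R := dotv g.1.1 h.1.1 + dotv g.1.2 h.1.2.

Definition hsymp g h : R := dotv g.1.1 h.1.2 - dotv h.1.1 g.1.2.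

Lemma hdot_ge0 g : 0 <= hdot g g.
Proof. by rewrite addr_ge0 ?dotvv_ge0. Qed.

Lemma hdotC g h : hdot g h = hdot h g.
Proof. by rewrite /hdot dotvC [X in _ + X]dotvC. Qed.

Lemma hdot_hsymp_le g h : hdot g h ^+ 2 + hsymp g h ^+ 2 <= hdot g g * hdot h h.
Proof.
by rewrite -(sqrrN (hsymp _ _)) /hsymp opprB; exact: hermitian_CS.
Qed.

Lemma heis_dist4 g h : mdist g h ^+ 4 =
  (hdot g g + hdot h h - 2 * hdot g h) ^+ 2 + (h.2 - g.2 + 2 * hsymp g h) ^+ 2.
Proof.
case: g h => [[x y] z] [[x' y'] z'].
rewrite /hdot /hsymp /=.
rewrite [mdist _ _]/(heis_dist _ _) /heis_dist /heis_mul /heis_inv /heis_norm.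
rewrite -[LHS]powR_mulrn ?powR_ge0// -powRrM mulVf ?pnatr_eq0// powRr1; last first.
  by rewrite addr_ge0 ?sqr_ge0.
congr (_ ^+ 2 + _ ^+ 2).
  rewrite big_split /= (_ : \sum_(i < n) _ = dotv (- x + x') (- x + x')); last first.
    by apply: eq_bigr => i _; rewrite expr2.
  rewrite (_ : \sum_(i < n) _ = dotv (- y + y') (- y + y')); last first.
    by apply: eq_bigr => i _; rewrite expr2.
  rewrite !(dotvDl, dotvDr, dotvNl, dotvNr) (dotvC x' x) (dotvC y' y); ring.
rewrite sumrB (_ : \sum_(i < n) _ = dotv x' (- y)); last by [].
rewrite (_ : \sum_(i < n) _ = dotv (- x) y'); last by [].
rewrite dotvNl dotvNr; ring.
Qed.

Definition origin : H := (0, 0, 0).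

Lemma heis_dist_origin4 g : mdist g origin ^+ 4 = hdot g g ^+ 2 + g.2 ^+ 2.
Proof.
rewrite heis_dist4 /hdot /hsymp /= !dotv0l !dotv0r; ring.
Qed.

Lemma hdot_inv g h : hdot g (heis_inv h) = - hdot g h.
Proof.
by case: h => [[x y] z]; rewrite /hdot /= !dotvNr opprD.
Qed.

Lemma hdot_inv_inv g : hdot (heis_inv g) (heis_inv g) = hdot g g.
Proof. by rewrite hdot_inv hdotC hdot_inv opprK. Qed.

Lemma hsymp_inv g h : hsymp g (heis_inv h) = - hsymp g h.
Proof.
by case: h => [[x y] z]; rewrite /hsymp /= dotvNr dotvNl -opprD.
Qed.

Lemma inv_vertical g : (heis_inv g).2 = - g.2.
Proof. by case: g => [[]]. Qed.

Lemma heis_dist_origin_inv g : mdist (heis_inv g) origin = mdist g origin.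
Proof.
apply/eqP; rewrite -(@eqrXn2 _ 4%N) ?mdist_ge0// !heis_dist_origin4.
by rewrite hdot_inv_inv inv_vertical sqrrN.
Qed.

(** Let A, B be the squared norms of the horizontal components of [g], [h], and
D, W the values of [hdot] and [hsymp].  In the plane, put P = (A, - g.2),
Q = (B, h.2) and S = (- 2 D, 2 W).  Then |P| and |Q| are the squared distances
of [g] and [h] to the origin, |P + Q + S| is the squared distance from [g] to
[h], and |S|^2 <= 4 A B <= 2 A^2 + 2 B^2 by Cauchy-Schwarz.  The parallelogram law for P + Q and
S, and again for P and Q, leaves a remainder that dominates half of the fourth
power of the distance from [g] to the inverse of [h]. *)
Lemma heis_dist_parallelogram g h :
  mdist g h ^+ 4 + mdist g (heis_inv h) ^+ 4 / 2 <=
  8 * (mdist g origin ^+ 4 + mdist h origin ^+ 4).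
Proof.
rewrite !heis_dist_origin4 !heis_dist4 hdot_inv_inv hdot_inv hsymp_inv inv_vertical.
have := hdot_hsymp_le g h.
move: (hdot g g) (hdot h h) (hdot g h) (hsymp g h) (g.2) (h.2) => A B D W z z' DW.
have h1 := sqr_ge0 (A - B); have h2 := sqr_ge0 (z + z').
have h3 := sqr_ge0 (A + B + 2 * D); have h4 := sqr_ge0 z.
have h5 := sqr_ge0 (z' - z - 2 * W + 2 * z').
lra.
Qed.

Lemma heis_dist_inv_le g h : mdist g (heis_inv h) <= mdist g origin + mdist h origin.
Proof.
by rewrite -(heis_dist_origin_inv h) (metric_sym (heis_inv h)) metric_triangle.
Qed.

(** The parallelogram inequality leaves no room for a distance between [h] and the
inverse of [g].  For a point of norm at most 1, the distance to its own inverse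
reaches 2 only if the vertical component vanishes. *)
Lemma antipodal g h : mdist g origin <= 1 -> mdist h origin <= 1 -> 2 <= mdist g h ->
  [/\ h = heis_inv g, g.2 = 0 & hdot g g = 1].
Proof.
move=> g1 h1 gh2.
have p4 (x y : R) : 0 <= x -> x <= y -> x ^+ 4 <= y ^+ 4.
  by move=> x0 xy; rewrite lerXn2r ?nnegrE// (le_trans x0).
have g4 := p4 _ _ (mdist_ge0 _ _) g1; have h4 := p4 _ _ (mdist_ge0 _ _) h1.
have gh4 := p4 _ _ (ler0n R 2) gh2.
rewrite !expr1n in g4 h4.
have e : mdist g (heis_inv h) = 0.
  have e0 : 0 <= mdist g (heis_inv h) ^+ 4 by rewrite exprn_ge0// mdist_ge0.
  apply/eqP; move: (heis_dist_parallelogram g h) => hp.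
  have : mdist g (heis_inv h) ^+ 4 == 0 by rewrite eq_le e0 andbT; lra.
  by rewrite expf_eq0.
have hE : h = heis_inv g.
  by rewrite (mdist_positivity _ _ e); case: (h) => [[x y] z]; rewrite /heis_inv /= !opprK.
move: gh4; rewrite hE heis_dist4 hdot_inv_inv hdot_inv hsymp_inv inv_vertical.
have -> : hsymp g g = 0 by rewrite /hsymp dotvC subrr.
move: g4; rewrite heis_dist_origin4; have := hdot_ge0 g.
move: (hdot g g) (g.2) => A z A0 g4 gh4.
have z0 : z = 0.
  by apply/eqP; rewrite -sqrf_eq0 eq_le sqr_ge0 andbT; nra.
split => //; rewrite z0 in gh4 g4; nra.
Qed.

(** The two fourth powers are (2 - 2 D)^2 + 4 W^2 and (2 + 2 D)^2 + 4 W^2; their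
sum is 8 + 8 (D^2 + W^2). *)
Lemma orthogonal_of_dist g h : g.2 = 0 -> h.2 = 0 -> hdot g g = 1 -> hdot h h = 1 ->
  mdist g h ^+ 4 <= 4 -> mdist g (heis_inv h) ^+ 4 <= 4 -> hdot g h = 0 /\ hsymp g h = 0.
Proof.
move=> g2 h2 gg hh; rewrite !heis_dist4 hdot_inv_inv hdot_inv hsymp_inv inv_vertical.
rewrite g2 h2 gg hh; move: (hdot g h) (hsymp g h) => D W h1 h2'.
have : D ^+ 2 + W ^+ 2 <= 0 by nra.
have := sqr_ge0 D; have := sqr_ge0 W => W0 D0 DW.
by split; apply/eqP; rewrite -sqrf_eq0 eq_le ?W0 ?D0 andbT; lra.
Qed.

(** The vectors (x_i, y_i) and (- y_i, x_i), that is, the [f i] and their products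
with the imaginary unit, form an orthonormal family of 2k vectors in R^2n. *)
Lemma orthonormal_le k (f : 'I_k -> H) :
  (forall i, hdot (f i) (f i) = 1) ->
  (forall i j, i != j -> hdot (f i) (f j) = 0 /\ hsymp (f i) (f j) = 0) ->
  (k <= n)%N.
Proof.
move=> f1 f0.
pose X : 'M[R]_(k, n) := \matrix_i (f i).1.1.
pose Y : 'M[R]_(k, n) := \matrix_i (f i).1.2.
have mulE (A B : 'I_k -> 'rV[R]_n) i j :
    ((\matrix_i A i) *m (\matrix_i B i)^T) i j = dotv (A i) (B j).
  by rewrite !mxE; apply: eq_bigr => l _; rewrite !mxE.
have dot_ij i j : hdot (f i) (f j) = (i == j)%:R.
  by case: eqVneq => [->|/f0[]].
have symp_ij i j : hsymp (f i) (f j) = 0.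
  by case: (eqVneq i j) => [->|/f0[]//]; rewrite /hsymp dotvC subrr.
have XY1 : X *m X^T + Y *m Y^T = 1%:M.
  by apply/matrixP => i j; rewrite mxE !mulE mxE; exact: dot_ij.
have XY0 : Y *m X^T = X *m Y^T.
  apply/matrixP => i j; rewrite !mulE; apply/esym/eqP; rewrite -subr_eq0 dotvC.
  by rewrite (dotvC (f i).1.2) dotvC -[X in X == _]/(hsymp (f i) (f j)) symp_ij.
pose M := block_mx X Y (- Y) X.
have MM : M *m M^T = 1%:M.
  have tN : (- Y)^T = - Y^T by apply/matrixP => i j; rewrite !mxE.
  rewrite tr_block_mx tN mulmx_block !mulNmx !mulmxN opprK.
  by rewrite XY0 !addNr [Y *m Y^T + _]addrC XY1 -scalar_mx_block.
have : (k + k <= n + n)%N.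
  rewrite -(mxrank1 R (k + k)) -MM.
  exact: leq_trans (mxrankM_maxl _ _) (rank_leq_col _).
by rewrite !addnn leq_double.
Qed.

Definition dilate (s : R) (g : H) : H := (s *: g.1.1, s *: g.1.2, s ^+ 2 * g.2).

Lemma mdist_dilate s g h : 0 <= s -> mdist (dilate s g) (dilate s h) = s * mdist g h.
Proof.
move=> s0; apply/eqP; rewrite -(@eqrXn2 _ 4%N) ?mulr_ge0 ?mdist_ge0//.
rewrite exprMn !heis_dist4 /hdot /hsymp /= !dotvZl !dotvZr.
by apply/eqP; ring.
Qed.

Lemma dilate_origin s : dilate s origin = origin.
Proof. by rewrite /dilate /= !scaler0 mulr0. Qed.

End geometry.

(** * Topology of the Heisenberg group *)

Section topology.
Context (R : realType) (n : nat).
Notation H := (heisenberg R n).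
Implicit Types (g h : H).

Lemma sqr_coord_le_dotv k (x y : 'rV[R]_k) i : (x 0 i - y 0 i) ^+ 2 <= dotv (x - y) (x - y).
Proof.
rewrite /dotv (bigD1 i)//= !mxE -expr2 lerDl sumr_ge0// => j _.
by rewrite -expr2 sqr_ge0.
Qed.

Lemma hdot_sub_le g h : hdot g g + hdot h h - 2 * hdot g h <= mdist g h ^+ 2.
Proof.
rewrite -(@ler_pXn2r _ 2%N) ?nnegrE ?sqr_ge0//; last first.
  rewrite /hdot (_ : _ - _ = dotv (g.1.1 - h.1.1) (g.1.1 - h.1.1) +
    dotv (g.1.2 - h.1.2) (g.1.2 - h.1.2)) ?addr_ge0 ?dotvv_ge0//.
  rewrite !(dotvDl, dotvDr, dotvNl, dotvNr).
  rewrite (dotvC h.1.1 g.1.1) (dotvC h.1.2 g.1.2); ring.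
by rewrite -exprM heis_dist4 lerDl sqr_ge0.
Qed.

Lemma mdist_horizontal g h :
  dotv (g.1.1 - h.1.1) (g.1.1 - h.1.1) + dotv (g.1.2 - h.1.2) (g.1.2 - h.1.2)
  <= mdist g h ^+ 2.
Proof.
apply: le_trans (hdot_sub_le g h); rewrite /hdot.
rewrite !(dotvDl, dotvDr, dotvNl, dotvNr).
rewrite (dotvC h.1.1 g.1.1) (dotvC h.1.2 g.1.2); lra.
Qed.

Lemma mdist_vertical g h : `|h.2 - g.2 + 2 * hsymp g h| <= mdist g h ^+ 2.
Proof.
rewrite -(@ler_pXn2r _ 2%N) ?nnegrE ?sqr_ge0// real_normK ?num_real//.
by rewrite -exprM heis_dist4 lerDr sqr_ge0.
Qed.

Lemma coord1_le g h i : `|g.1.1 0 i - h.1.1 0 i| <= mdist g h.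
Proof.
rewrite -(@ler_pXn2r _ 2%N) ?nnegrE ?mdist_ge0// real_normK ?num_real//.
apply: le_trans (sqr_coord_le_dotv _ _ _) _; apply: le_trans (mdist_horizontal g h).
by rewrite lerDl dotvv_ge0.
Qed.

Lemma coord2_le g h i : `|g.1.2 0 i - h.1.2 0 i| <= mdist g h.
Proof.
rewrite -(@ler_pXn2r _ 2%N) ?nnegrE ?mdist_ge0// real_normK ?num_real//.
apply: le_trans (sqr_coord_le_dotv _ _ _) _; apply: le_trans (mdist_horizontal g h).
by rewrite lerDr dotvv_ge0.
Qed.

Lemma cvg_dotv T (F : set_system T) {FF : Filter F} k (x y : T -> 'rV[R]_k) (a b : 'rV[R]_k) :
  (forall i, x t 0 i @[t --> F] --> a 0 i) ->
  (forall i, y t 0 i @[t --> F] --> b 0 i) ->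
  dotv (x t) (y t) @[t --> F] --> dotv a b.
Proof.
move=> xa yb; rewrite /dotv; apply: cvg_big.
  exact: add_continuous.
by move=> i _; exact: cvgM.
Qed.

Section cvg.
Context T (F : set_system T) {FF : Filter F} (f : T -> H) (g : H).

Lemma cvg_heisP : f @ F --> g <-> mdist g (f t) @[t --> F] --> (0 : R).
Proof.
split=> [fg|fg].
  have : mdist g (f t) @[t --> F] --> mdist g g.
    by apply: cvg_mdist => //; exact: cvg_cst.
  by rewrite mdistxx.
apply/metricType_numDomainType.cvgrPdist_lt => e e0.
move/cvgrPdist_lt : fg => /(_ e e0); apply: filterS => t.
by rewrite sub0r normrN ger0_norm// mdist_ge0.
Qed.

Lemma cvg_heis :
  (forall i, (f t).1.1 0 i @[t --> F] --> g.1.1 0 i) ->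
  (forall i, (f t).1.2 0 i @[t --> F] --> g.1.2 0 i) ->
  (f t).2 @[t --> F] --> g.2 -> f @ F --> g.
Proof.
move=> f1 f2 f3; apply/cvg_heisP.
have d4 : mdist g (f t) ^+ 4 @[t --> F] --> (0 : R).
  under eq_fun do rewrite heis_dist4 /hdot /hsymp.
  have -> : 0 = (dotv g.1.1 g.1.1 + dotv g.1.2 g.1.2 +
    (dotv g.1.1 g.1.1 + dotv g.1.2 g.1.2) -
    2 * (dotv g.1.1 g.1.1 + dotv g.1.2 g.1.2)) ^+ 2 +
    (g.2 - g.2 + 2 * (dotv g.1.1 g.1.2 - dotv g.1.1 g.1.2)) ^+ 2 by ring.
  have c (A : 'rV[R]_n) i : A 0 i @[t --> F] --> A 0 i by exact: cvg_cst.
  have cM (u : T -> R) (l : R) : u @ F --> l -> 2 * u t @[t --> F] --> 2 * l.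
    by move=> ul; apply: cvgM => //; exact: cvg_cst.
  apply: cvgD; apply: cvg_exprn.
    apply: cvgB; last by apply: cM; apply: cvgD; exact: cvg_dotv.
    by apply: cvgD; [exact: cvg_cst|apply: cvgD; exact: cvg_dotv].
  apply: cvgD; first by apply: cvgB => //; exact: cvg_cst.
  by apply: cM; apply: cvgB; exact: cvg_dotv.
apply/cvgrPdist_lt => e e0.
move/cvgrPdist_lt : d4 => /(_ (e ^+ 4)); rewrite exprn_gt0// => /(_ isT).
apply: filterS => t; rewrite !sub0r !normrN normrX ger0_norm ?mdist_ge0//.
by rewrite ltr_pXn2r ?nnegrE ?mdist_ge0 ?(ltW e0).
Qed.

Lemma cvg_coord1 i : f @ F --> g -> (f t).1.1 0 i @[t --> F] --> g.1.1 0 i.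
Proof.
move=> fg; apply/cvgrPdist_lt => e e0.
have h : \forall t \near F, mdist g (f t) < e.
  exact: (metricType_numDomainType.cvgr_dist_lt fg e0).
by apply: filterS h => t; exact: le_lt_trans (coord1_le _ _ _).
Qed.

Lemma cvg_coord2 i : f @ F --> g -> (f t).1.2 0 i @[t --> F] --> g.1.2 0 i.
Proof.
move=> fg; apply/cvgrPdist_lt => e e0.
have h : \forall t \near F, mdist g (f t) < e.
  exact: (metricType_numDomainType.cvgr_dist_lt fg e0).
by apply: filterS h => t; exact: le_lt_trans (coord2_le _ _ _).
Qed.

(** The vertical coordinate is not Lipschitz, but it differs from the vertical
part of g^-1 (f t) by a twist that depends continuously on the
horizontal coordinates. *)
Lemma cvg_coord3 : f @ F --> g -> (f t).2 @[t --> F] --> g.2.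
Proof.
move=> fg.
have c (A : 'rV[R]_n) i : A 0 i @[t --> F] --> A 0 i by exact: cvg_cst.
have v0 : (f t).2 - g.2 + 2 * hsymp g (f t) @[t --> F] --> (0 : R).
  apply/cvgrPdist_lt => e e0.
  have d2 : mdist g (f t) ^+ 2 @[t --> F] --> (0 : R).
    rewrite (_ : 0 = 0 ^+ 2); last by rewrite expr0n.
    by apply: cvg_exprn; exact/cvg_heisP.
  move/cvgrPdist_lt : d2 => /(_ e e0); apply: filterS => t.
  rewrite !sub0r !normrN [X in X < _ -> _]ger0_norm ?sqr_ge0//.
  exact: le_lt_trans (mdist_vertical _ _).
have s1 : hsymp g (f t) @[t --> F] --> (0 : R).
  rewrite [X in _ --> X](_ : 0 = dotv g.1.1 g.1.2 - dotv g.1.1 g.1.2);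
    last by rewrite subrr.
  rewrite /hsymp; apply: cvgB; apply: cvg_dotv => // i.
    exact: cvg_coord2.
  exact: cvg_coord1.
have s0 : g.2 - 2 * hsymp g (f t) @[t --> F] --> g.2 - 2 * 0.
  by apply: cvgB; [exact: cvg_cst|apply: cvgM; [exact: cvg_cst|exact: s1]].
have -> : g.2 = 0 + (g.2 - 2 * 0) by ring.
have -> : (fun t => (f t).2) = (fun t => ((f t).2 - g.2 + 2 * hsymp g (f t)) +
    (g.2 - 2 * hsymp g (f t))) by apply/funext => t; ring.
exact: cvgD.
Qed.

End cvg.

End topology.

Section separability.
Context (R : realType) (n : nat).
Notation H := (heisenberg R n).

Lemma cvg_floor_approx (x : R) :
  (Num.floor (x * m.+1%:R))%:~R / m.+1%:R @[m --> \oo] --> x.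
Proof.
apply/cvgrPdist_lt => e e0.
apply: filterS (near_infty_natSinv_lt (PosNum e0)) => m /= me.
have m0 : 0 < m.+1%:R :> R by [].
have /andP[h1 h2] := floor_itv (x * m.+1%:R).
apply: le_lt_trans me.
have -> : x - (Num.floor (x * m.+1%:R))%:~R / m.+1%:R =
    (x * m.+1%:R - (Num.floor (x * m.+1%:R))%:~R) / m.+1%:R.
  by rewrite mulrBl mulfK// lt0r_neq0.
rewrite ger0_norm; last by rewrite divr_ge0 ?subr_ge0// ltW.
rewrite ler_pdivrMr// mulVf ?lt0r_neq0// lerBlDl (le_trans (ltW h2))//.
by rewrite intrD.
Qed.

Definition grid_point (q : 'rV[int]_n * 'rV[int]_n * int * nat) : H :=
  let: (a, b, c, m) := q in
  (\row_i ((a 0 i)%:~R / m.+1%:R), \row_i ((b 0 i)%:~R / m.+1%:R),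
   c%:~R / m.+1%:R).

(** Rounding the coordinates to multiples of 1 / (m + 1). *)
Lemma grid_point_dense (g : H) (e : R) : 0 < e ->
  exists q, mdist (grid_point q) g < e.
Proof.
move=> e0.
pose q m := (\row_i Num.floor (g.1.1 0 i * m.+1%:R),
  \row_i Num.floor (g.1.2 0 i * m.+1%:R), Num.floor (g.2 * m.+1%:R), m)
  : 'rV[int]_n * 'rV[int]_n * int * nat.
have qg : (fun m => grid_point (q m)) @ \oo --> g.
  apply: cvg_heis => [i|i|]; last exact: cvg_floor_approx.
    by under eq_fun => m do rewrite /= !mxE; exact: cvg_floor_approx.
  by under eq_fun => m do rewrite /= !mxE; exact: cvg_floor_approx.
have [m _ hm] : \forall m \near \oo, mdist g (grid_point (q m)) < e.
  exact: (metricType_numDomainType.cvgr_dist_lt qg e0).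
by exists (q m); rewrite metric_sym; apply: hm => /=.
Qed.

End separability.

(** * Isometric copies of R^n and H^k *)

Section retracts.
Context (R : realType) (p : R).

Lemma embeds_euclidean_heisenberg n :
  embeds_isometrically p (euclidean R n) (heisenberg R n).
Proof.
pose iota (x : euclidean R n) : heisenberg R n := (x : 'rV[R]_n, 0, 0).
pose r (g : heisenberg R n) : euclidean R n := g.1.1.
apply: (@embeds_of_retract _ _ _ _ iota r) => // [x x'|g].
  apply/eqP; rewrite -(@eqrXn2 _ 4%N) ?mdist_ge0//; apply/eqP.
  rewrite heis_dist4 /hdot /hsymp /= !dotv0r !(addr0, subr0, mulr0) expr0n addr0.
  rewrite [mdist x x'](euclidean_normE (x - x' : 'rV[R]_n)) (exprM _ 2 2).
  rewrite sqr_sqrtr ?dotvv_ge0// !(dotvDl, dotvDr, dotvNl, dotvNr) (dotvC x' x).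
  by congr (_ ^+ 2); ring.
apply/(metricType_numDomainType.cvgrPdist_lt (FF := nbhs_filter g)) => e e0.
have h : \forall h \near g, mdist g h < e.
  exact: (metricType_numDomainType.cvgr_dist_lt (@cvg_id _ (nbhs g)) e0).
apply: (@filterS _ _ (nbhs_filter g) _ _ _ h) => {}h; apply: le_lt_trans.
rewrite [mdist (r g) _](euclidean_normE (g.1.1 - h.1.1 : 'rV[R]_n)).
rewrite -(@ler_pXn2r _ 2%N) ?nnegrE ?sqrtr_ge0 ?mdist_ge0// sqr_sqrtr ?dotvv_ge0//.
by apply: le_trans (mdist_horizontal g h); rewrite lerDl dotvv_ge0.
Qed.

Lemma dotv_row_mx0 k m (x y : 'rV[R]_k) :
  dotv (row_mx x (0 : 'rV[R]_m)) (row_mx y 0) = dotv x y.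
Proof.
rewrite /dotv big_split_ord /= [X in _ + X]big1 ?addr0; last first.
  by move=> i _; rewrite !row_mxEr !mxE mul0r.
by apply: eq_bigr => i _; rewrite !row_mxEl.
Qed.

Lemma embeds_heisenberg k n : (k <= n)%N ->
  embeds_isometrically p (heisenberg R k) (heisenberg R n).
Proof.
move=> /subnKC <-; move: (n - k)%N => m {n}.
pose iota (g : heisenberg R k) : heisenberg R (k + m) :=
  (row_mx g.1.1 0, row_mx g.1.2 0, g.2).
pose r (g : heisenberg R (k + m)) : heisenberg R k :=
  (lsubmx g.1.1, lsubmx g.1.2, g.2).
apply: (@embeds_of_retract _ _ _ _ iota r) => [g h|g|g].
- apply/eqP; rewrite -(@eqrXn2 _ 4%N) ?mdist_ge0//.
  by rewrite !heis_dist4 /hdot /hsymp /= !dotv_row_mx0.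
- by case: g => [[x y] z]; rewrite /r /iota /= !row_mxKl.
- have idg : id @ nbhs g --> g by exact: cvg_id.
  apply: (cvg_heis (FF := nbhs_filter g)) => [i|i|]; rewrite /r /=.
  + by under eq_fun do rewrite mxE; rewrite mxE; exact: (cvg_coord1 (FF := nbhs_filter g) idg).
  + by under eq_fun do rewrite mxE; rewrite mxE; exact: (cvg_coord2 (FF := nbhs_filter g) idg).
  + exact: (cvg_coord3 (FF := nbhs_filter g) idg).
Qed.

End retracts.

(** * The rank of the Wasserstein space over H^n *)

Section ultra.
Context (R : realType) (n : nat) (U : set_system nat) {UU : UltraFilter U}.
Notation H := (heisenberg R n).

Lemma ultra_cvg_heis (f : nat -> H) (M : R) :
  (forall m, mdist (f m) (origin R n) <= M) -> exists g : H, f @ U --> g.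
Proof.
move=> fM.
have /choice[x hx] i : exists l : R, (f m).1.1 0 i @[m --> U] --> l.
  apply: (@ultra_cvg_bounded _ _ _ _ M) => m; apply: le_trans (fM m).
  by have := coord1_le (f m) (origin R n) i; rewrite /= mxE subr0.
have /choice[y hy] i : exists l : R, (f m).1.2 0 i @[m --> U] --> l.
  apply: (@ultra_cvg_bounded _ _ _ _ M) => m; apply: le_trans (fM m).
  by have := coord2_le (f m) (origin R n) i; rewrite /= mxE subr0.
have [z hz] : exists l : R, (f m).2 @[m --> U] --> l.
  apply: (@ultra_cvg_bounded _ _ _ _ (M ^+ 2)) => m.
  have M0 : 0 <= M by exact: le_trans (mdist_ge0 _ _) (fM m).
  apply: (@le_trans _ _ (mdist (f m) (origin R n) ^+ 2)); last first.
    by rewrite ler_pXn2r ?nnegrE ?mdist_ge0.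
  have := mdist_vertical (f m) (origin R n).
  by rewrite /hsymp /= dotv0l dotv0r subrr mulr0 addr0 sub0r normrN.
exists (\row_i x i, \row_i y i, z).
by apply: cvg_heis => [i|i|//]; rewrite /= mxE.
Qed.

End ultra.

Section rank.
Context (R : realType) (p : R) (p1 : 1 < p) (k n : nat).
Notation H := (heisenberg R n).
Notation E := (euclidean R k).
Notation o := (origin R n).

Let p0 : 0 < p. Proof. exact: lt_trans p1. Qed.

Definition axis_point (t : R) (i : 'I_k) (b : bool) : E :=
  ((-1) ^+ b * t) *: delta_mx 0 i.

Lemma dotv_delta (i j : 'I_k) :
  dotv (delta_mx 0 i) (delta_mx 0 j) = (i == j)%:R :> R.
Proof.
rewrite /dotv (bigD1 i)//= !mxE !eqxx/= mul1r big1 ?addr0 // => l li.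
by rewrite !mxE (negbTE li) andbF mul0r.
Qed.

Lemma mdist_euclideanE (x y : 'rV[R]_k) :
  mdist (x : E) (y : E) = Num.sqrt (dotv x x + dotv y y - 2 * dotv x y).
Proof.
rewrite [LHS](euclidean_normE (x - y)); congr Num.sqrt.
by rewrite !(dotvDl, dotvDr, dotvNl, dotvNr) (dotvC y x); ring.
Qed.

Lemma mdist_axis_origin t i b : 0 <= t -> mdist (axis_point t i b) (0 : E) = t.
Proof.
move=> t0; rewrite mdist_euclideanE !dotv0r dotvZl dotvZr dotv_delta eqxx.
rewrite (_ : _ - _ = t ^+ 2); first by rewrite sqrtr_sqr ger0_norm.
by case: b => /=; rewrite ?expr0 ?expr1; ring.
Qed.

Lemma mdist_axis_opp t i : 0 <= t ->
  mdist (axis_point t i false) (axis_point t i true) = 2 * t.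
Proof.
move=> t0; rewrite mdist_euclideanE !dotvZl !dotvZr dotv_delta eqxx.
rewrite (_ : _ - _ = (2 * t) ^+ 2); first by rewrite sqrtr_sqr ger0_norm// mulr_ge0.
by rewrite /= expr0 expr1; ring.
Qed.

Lemma mdist_axis_orth t i j b b' : 0 <= t -> i != j ->
  mdist (axis_point t i b) (axis_point t j b') = Num.sqrt 2 * t.
Proof.
move=> t0 ij; rewrite mdist_euclideanE !dotvZl !dotvZr !dotv_delta !eqxx (negbTE ij).
rewrite (_ : _ - _ = 2 * t ^+ 2).
  by rewrite sqrtrM// sqrtr_sqr ger0_norm.
by case: b; case: b' => /=; rewrite ?expr0 ?expr1; ring.
Qed.

Variable f : wasserstein p E -> wasserstein p H.
Hypothesis f_iso : isometric_embedding f.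

Let mu t i b := f (wdirac p (axis_point t i b)).
Let mu0 := f (wdirac p (0 : E)).

Let W_dirac (x y : E) :
  (wasserstein_dist (f (wdirac p x)) (f (wdirac p y)) = (mdist x y)%:E)%E.
Proof. by rewrite f_iso wasserstein_dist_dirac. Qed.

Local Open Scope ereal_scope.

Let C := fine (Lp_dist p (sval mu0) o).

Let C0 : (0 <= C)%R. Proof. by rewrite fine_ge0// Lp_dist_ge0. Qed.

Let Lp_dist_mu t i b : (0 <= t)%R -> Lp_dist p (sval (mu t i b)) o <= (t + C)%:E.
Proof.
move=> t0; apply: le_trans (Lp_dist_le_wasserstein p1 _ mu0 o) _.
rewrite W_dirac mdist_axis_origin// EFinD leeD2l// /C fineK//.
by rewrite ge0_fin_numE ?Lp_dist_ge0// Lp_dist_lty//; exact: svalP mu0.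
Qed.

(** [concentration] is applied with [s] the group inverse, and with the constant
[K] that [near_equality] provides for [eta = e `^ p / 4].  It remains to compare
M = t + C with t: as the ratio M / t tends to 1, its p-th power is eventually
at most [1 + delta], and [delta] is chosen such that the bound
2 L M^p - K (2 t)^p becomes smaller than 4 eta t^p = (e t)^p. *)
Lemma axis_concentration (e : R) : (0 < e)%R -> exists2 T : R, (0 < T)%R &
  forall t i b, (T <= t)%R -> exists c : H, Lp_dist p (sval (mu t i b)) c <= (e * t)%:E.
Proof.
move=> e0.
have ep0 : (0 < e `^ p)%R by rewrite powR_gt0.
pose eta : R := (e `^ p / 4)%R; have eta0 : (0 < eta)%R by rewrite divr_gt0.
have [K K0 hK] := near_equality p1 eta0.
pose P : R := (K * 2 `^ p)%R; have P0 : (0 <= P)%R by rewrite mulr_ge0// powR_ge0.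
pose delta : R := (eta / (2 * eta + P))%R.
have den0 : (0 < 2 * eta + P)%R by rewrite ltr_pwDl// mulr_gt0.
have delta0 : (0 < delta)%R by rewrite divr_gt0.
pose r : R := ((1 + delta) `^ p^-1)%R.
have rp : (r `^ p = 1 + delta)%R.
  by rewrite /r -powRrM mulVf ?gt_eqF// powRr1// addr_ge0// ltW.
have r1 : (1 < r)%R.
  have : (1 `^ p^-1 < r)%R.
    by apply: gt0_ltr_powR; rewrite ?invr_gt0 ?nnegrE ?addr_ge0 ?(ltW delta0)// ltrDl.
  by rewrite powR1.
pose T : R := (C / (r - 1) + 1)%R.
have T0 : (0 < T)%R by rewrite ltr_wpDl// divr_ge0// subr_ge0 ltW.
exists T => // t i b Tt.
have t0 : (0 < t)%R by exact: lt_le_trans Tt.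
have tCr : (t + C <= r * t)%R.
  have : (C / (r - 1) <= t)%R by apply: le_trans Tt; rewrite lerDl.
  rewrite ler_pdivrMr ?subr_gt0//; lra.
have [||||||||c hc] := @concentration _ p p1 H _ _ (@grid_point_dense R n) (@heis_inv R n) o
  K (eta + K * 2 `^ (p - 1)) (r * t) (2 * t) ((e * t) `^ p) (mu t i b) (mu t i (~~ b)) K0.
- by rewrite addr_ge0 ?mulr_ge0 ?powR_ge0// ltW.
- by rewrite mulr_ge0// ltW.
- exact: powR_ge0.
- move=> u v; apply: (le_trans _ (hK _ _ _ _ (mdist_ge0 u o) (mdist_ge0 v o)
    (mdist_ge0 u v) (mdist_ge0 u (heis_inv v)) _ _ _)) => //.
  + by rewrite (metric_sym v) metric_triangle.
  + exact: heis_dist_inv_le.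
  + exact: heis_dist_parallelogram.
- by apply: le_trans (Lp_dist_mu _ _ (ltW t0)) _; rewrite lee_fin.
- by apply: le_trans (Lp_dist_mu _ _ (ltW t0)) _; rewrite lee_fin.
- rewrite W_dirac lee_fin; case: b => /=; last by rewrite mdist_axis_opp// ltW.
  by rewrite metric_sym mdist_axis_opp// ltW.
- have tp0 : (0 < t `^ p)%R by rewrite powR_gt0.
  rewrite !powRM ?ler0n ?(ltW t0) ?(ltW e0) ?(le_trans _ (ltW r1))// rp.
  have two : (2 `^ p = 2 * 2 `^ (p - 1) :> R)%R by rewrite mulr_powRB1.
  have hd : (delta * (2 * eta + P) = eta)%R by rewrite /delta divfK// gt_eqF.
  have ee : (e `^ p = 4 * eta)%R by rewrite /eta mulrC divfK// gt_eqF.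
  rewrite ee -subr_gt0.
  have -> : (4 * eta * t `^ p - (2 * (eta + K * 2 `^ (p - 1)) * ((1 + delta) * t `^ p) -
    K * (2 `^ p * t `^ p)) = (2 * eta - delta * (2 * eta + P)) * t `^ p)%R.
    by rewrite /P two; ring.
  by rewrite hd mulr_gt0//; lra.
exists c; have et0 : (0 <= e * t)%R by rewrite mulr_ge0// ltW.
have -> : Lp_dist p (sval (mu t i b)) c = (Lp_dist p (sval (mu t i b)) c `^ p) `^ p^-1.
  by rewrite -poweRrM mulfV ?gt_eqF// poweRe1// Lp_dist_ge0.
have -> : (e * t)%:E = ((e * t) `^ p)%:E `^ p^-1.
  by rewrite poweR_EFin -powRrM mulfV ?gt_eqF// powRr1.
apply: gt0_ler_poweR => //; first by rewrite invr_ge0 ltW.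
  by rewrite in_itv/= leey andbT poweR_ge0.
by rewrite in_itv/= leey andbT lee_fin powR_ge0.
Qed.

Local Close Scope ereal_scope.

(** The concentration points at a large scale [t], rescaled by [1 / t]: up to the
concentration error they are as far from each other as the vectors e_i, - e_i,
hence form an approximate orthoplex around the origin. *)
Lemma exists_approximate_axes (e : R) : 0 < e -> exists h : 'I_k -> bool -> H,
  [/\ forall i b, mdist (h i b) o <= 1 + 2 * e,
      forall i, 2 - 2 * e <= mdist (h i false) (h i true) &
      forall i j b b', i != j -> mdist (h i b) (h j b') <= Num.sqrt 2 + 2 * e].
Proof.
move=> e0; have [T T0 hT] := axis_concentration e0.
(* the second bound makes the distance C of mu0 to the origin negligible *)
pose t := Num.max T (C / e).
have Tt : T <= t by rewrite le_max lexx.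
have Ct : C <= e * t by rewrite mulrC -ler_pdivrMr// le_max lexx orbT.
have t0 : 0 < t by exact: lt_le_trans Tt.
have /choice[c hc] i : exists c : bool -> H, forall b,
    (Lp_dist p (sval (mu t i b)) (c b) <= (e * t)%:E)%E.
  by have /choice[c hc] := fun b => hT t i b Tt; exists c.
have V0 : 0 <= t^-1 by rewrite invr_ge0 ltW.
exists (fun i b => dilate t^-1 (c i b)); split=> [i b|i|i j b b' ij].
- rewrite -(@dilate_origin R n t^-1) mdist_dilate// mulrC ler_pdivrMr//.
  rewrite -lee_fin; apply: le_trans (mdist_le_Lp_dist p1 (sval (mu t i b)) _ _) _.
  apply: le_trans (leeD (hc i b) (Lp_dist_mu i b (ltW t0))) _.
  by rewrite lee_fin; lra.
- rewrite mdist_dilate// [t^-1 * _]mulrC ler_pdivlMr//.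
  have := wasserstein_le_Lp_dist p1 (@grid_point_dense R n)
    (mu t i false) (mu t i true) (c i true).
  rewrite W_dirac mdist_axis_opp ?(ltW t0)// => h.
  have := le_trans h (leeD2r _ (Lp_dist_triangle p1 _ _ (c i false))).
  rewrite -addeA => {}h.
  have := le_trans h (leeD (hc i false) (leeD2l _ (hc i true))).
  by rewrite lee_fin (metric_sym (c i true)); lra.
- rewrite mdist_dilate// [t^-1 * _]mulrC ler_pdivrMr//.
  have := mdist_le_wasserstein p1 (mu t i b) (mu t j b') (c i b) (c j b').
  rewrite W_dirac mdist_axis_orth ?(ltW t0)// => h.
  have := le_trans h (leeD (leeD2r _ (hc i b)) (hc j b')).
  by rewrite lee_fin; lra.
Qed.

Lemma embeds_euclidean_le : (k <= n)%N.
Proof.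
have /choice[h hh] m : exists h : 'I_k -> bool -> H,
    [/\ forall i b, mdist (h i b) o <= 1 + 2 * m.+1%:R^-1,
      forall i, 2 - 2 * m.+1%:R^-1 <= mdist (h i false) (h i true) &
      forall i j b b', i != j -> mdist (h i b) (h j b') <= Num.sqrt 2 + 2 * m.+1%:R^-1].
  by apply: exists_approximate_axes; rewrite invr_gt0.
have [U [UU oU]] := ultraFilterLemma eventually_filter.
have UP := @ultra_proper _ _ UU.
have harm : (fun m => m.+1%:R^-1 : R) @ U --> (0 : R).
  exact: cvg_trans (cvg_app _ oU) (@cvg_harmonic R).
have harm2 : 2 * m.+1%:R^-1 @[m --> U] --> (0 : R).
  by rewrite -(mulr0 2); apply: cvgM => //; exact: cvg_cst.
have harmD (a : R) : a + 2 * m.+1%:R^-1 @[m --> U] --> a.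
  by rewrite -[X in _ --> X]addr0; apply: cvgD => //; exact: cvg_cst.
have harmB (a : R) : a - 2 * m.+1%:R^-1 @[m --> U] --> a.
  by rewrite -[X in _ --> X]subr0; apply: cvgB => //; exact: cvg_cst.
have /choice[g hg] ib : exists g : H, h m ib.1 ib.2 @[m --> U] --> g.
  apply: (@ultra_cvg_heis _ _ _ _ _ 3) => m; have [h1 _ _] := hh m.
  apply: le_trans (h1 _ _) _.
  have : m.+1%:R^-1 <= 1 :> R by rewrite invf_le1// ler1n.
  by move: (m.+1%:R^-1) => v v1; lra.
have dlim ib ib' : mdist (h m ib.1 ib.2) (h m ib'.1 ib'.2) @[m --> U] --> mdist (g ib) (g ib').
  exact: cvg_mdist.
have g1 ib : mdist (g ib) o <= 1.
  have cl : mdist (h m ib.1 ib.2) o @[m --> U] --> mdist (g ib) o.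
    by apply: cvg_mdist => //; exact: cvg_cst.
  by apply: (ler_cvg_to cl (harmD 1)); apply: nearW => m; have [] := hh m.
have g2 i : 2 <= mdist (g (i, false)) (g (i, true)).
  by apply: (ler_cvg_to (harmB 2) (dlim _ _)); apply: nearW => m; have [] := hh m.
have g3 i j b b' : i != j -> mdist (g (i, b)) (g (j, b')) ^+ 4 <= 4.
  move=> ij; have : mdist (g (i, b)) (g (j, b')) <= Num.sqrt 2.
    apply: (ler_cvg_to (dlim _ _) (harmD _)); apply: nearW => m.
    by have [_ _] := hh m; apply.
  rewrite -(@ler_pXn2r _ 4%N) ?nnegrE ?mdist_ge0 ?sqrtr_ge0//.
  by rewrite [X in _ <= X -> _](exprM _ 2 2) sqr_sqrtr// (_ : 2 ^+ 2 = 4)//; ring.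
have anti i := antipodal (g1 (i, false)) (g1 (i, true)) (g2 i).
apply: (@orthonormal_le R n k (fun i => g (i, false))) => [i|i j ij].
  by have [] := anti i.
have [hi zi ni] := anti i; have [hj zj nj] := anti j.
apply: orthogonal_of_dist => //; first exact: g3.
by rewrite -hj; exact: g3.
Qed.

End rank.

Theorem corollary4p1 (R : realType) (p : R) (k n : nat)
    (hp : 1 < p) (hk : (1 <= k)%N) (hn : (1 <= n)%N) :
  (embeds_isometrically p (euclidean R k) (heisenberg R n) <-> (k <= n)%N) /\
  (embeds_isometrically p (heisenberg R k) (heisenberg R n) <-> (k <= n)%N).
Proof.
have RH := embeds_euclidean_heisenberg p k.
split; split => [|kn].
- by move=> [f]; exact: embeds_euclidean_le.
- exact: embeds_trans RH (embeds_heisenberg p kn).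
- by move=> /(embeds_trans RH) [f]; exact: embeds_euclidean_le.
- exact: embeds_heisenberg.
Qed.
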